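(* Let $\Gamma=\langle s_1,\ldots,s_r\rangle$ be a free group of finite rank $r$ with free generating set $s_1,\dots,s_r$, let $\alpha$ be a measure-preserving action of $\Gamma$ on a standard probability space $(X,\mathcal B_X,\nu)$, let $G$ be a compact metrizable group, let $\beta$ be an action of $\Gamma$ on $G$ by group-automorphisms, and let $\sigma:\Gamma\times X\to G$ be a cocycle for $\beta$ and $\alpha$. Suppose that $G$ is totally disconnected and that there exists a finite-index clopen normal subgroup $N\lhd G$ such that $\{gN: g\in G\}$ is a generating partition for $\beta$. Let $\mu$ denote the Haar probability measure on $G$. Suppose also that there is a finite-entropy generating partition for $\alpha$. Then $$f_{\nu\times\mu}(\alpha\times_\sigma\beta)=f_\nu(\alpha)+f_\mu(\beta).$$
   Context: Skew-products: a cocycle for $\beta$ and $\alpha$ is a measurable map $\sigma:\Gamma\times X\to G$ with $\sigma(gh,x)=(\beta_g\sigma(h,x))\cdot\sigma(g,\alpha_h x)$ for all $g,h\in\Gamma$, $x\in X$. The skew-product action $\alpha\times_\sigma\beta$ of $\Gamma$ on $(X\times G,\nu\times\mu)$ is $(\alpha\times_\sigma\beta)_g(x,y)=(\alpha_g x,(\beta_g y)\cdot\sigma(g,x))$. The $f$-invariant: let $\alpha$ be a measure-preserving action of $\Gamma=\langle s_1,\dots,s_r\rangle$ on a standard probability space $(X,\mathcal B_X,\nu)$; write $\alpha_g$ for $\alpha(g)$. For a countable measurable partition $\mathcal P$ of $X$, its Shannon entropy is $H_\nu(\mathcal P)=-\sum_{P\in\mathcal P}\nu(P)\log\nu(P)$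 (with $0\log 0=0$); $\mathcal P$ has finite entropy if $H_\nu(\mathcal P)<\infty$. The join is $\mathcal P\vee\mathcal Q=\{P\cap Q: P\in\mathcal P,Q\in\mathcal Q\}$, and for finite $W\subset\Gamma$, $\mathcal P^W=\bigvee_{w\in W}\alpha_w\mathcal P$. Let $B(n)$ be the ball of radius $n$ about the identity of $\Gamma$ in the word metric for $s_1,\dots,s_r$. If $H_\nu(\mathcal P)<\infty$ define $$F_\nu(\alpha,\mathcal P)=(1-2r)H_\nu(\mathcal P)+\sum_{i=1}^r H_\nu(\mathcal P\vee\alpha_{s_i}\mathcal P),\qquad f_\nu(\alpha,\mathcal P)=\inf_{n>0}F_\nu(\alpha,\mathcal P^{B(n)}).$$ $\mathcal P$ is generating for $\alpha$ if the smallest $\alpha(\Gamma)$-invariant $\sigma$-algebra containing $\mathcal P$ is $\mathcal B_X$ up to sets of measure zero. It is a known theorem that $f_\nu(\alpha,\mathcal P)$ takes the same value for all finite-entropy generating partitions $\mathcal P$; this common value, in $[-\infty,\infty)$, is the $f$-invariant $f_\nu(\alpha)$. It is undefined if there is no finite-entropy generating partition. *)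

(* Defs.v *)
From HB Require Import structures.
From mathcomp Require Import all_boot all_order all_algebra.
From mathcomp Require Import all_classical all_reals all_analysis.

Set Implicit Arguments.
Unset Strict Implicit.
Unset Printing Implicit Defensive.

Import Order.TTheory GRing.Theory Num.Theory.

Local Open Scope classical_set_scope.
Local Open Scope ring_scope.

(** ** Topological groups *)

(* The [Pointed] component is only there because [g_sigma_algebraType] is
   restricted to pointed types; a group is nonempty, and nothing below refers
   to the base point. *)
HB.mixin Record isTopologicalGroup G of Group G & PointedTopological G := {
  mulg_continuous : continuous (fun z : G * G => (z.1 * z.2)%g) ;
  invg_continuous : continuous (fun x : G => (x^-1)%g)
}.

#[short(type="topologicalGroupType")]
HB.structure Definition TopologicalGroup :=
  {G of isTopologicalGroup G & Group G & PointedTopological G}.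

Definition metrizable (R : realType) (T : topologicalType) : Prop :=
  exists (M : metricType R) (f : T -> M) (g : M -> T),
    [/\ cancel f g, cancel g f, continuous f & continuous g].

Definition borel (G : topologicalGroupType) := g_sigma_algebraType (@open G).

(* Left invariance determines the Borel probability measure [mu], which is then
   regular and bi-invariant when [G] is compact and metrizable. *)
Definition is_haar (R : realType) (G : topologicalGroupType)
    (mu : probability (borel G) R) : Prop :=
  forall (g : G) (A : set (borel G)), measurable A ->
    mu [set (g * x)%g | x in A] = mu A.

Definition subgroup (G : groupType) (N : set G) : Prop :=
  N 1%g /\ forall x y, N x -> N y -> N (x * y^-1)%g.

Definition normal_subgroup (G : groupType) (N : set G) : Prop :=
  subgroup N /\ forall g x, N x -> N (g * x * g^-1)%g.

Definition left_cosets (G : groupType) (N : set G) : set (set G) :=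
  [set [set (g * x)%g | x in N] | g in [set: G]].

(** ** Free groups *)

Section Words.
Variables (Gamma : groupType) (r : nat) (s : 'I_r -> Gamma).

(* The letter [(i, false)] stands for [s i] and [(i, true)] for its inverse. *)
Definition letter_val (l : 'I_r * bool) : Gamma :=
  if l.2 then (s l.1)^-1%g else s l.1.

Definition word_val (w : seq ('I_r * bool)) : Gamma :=
  foldr (fun l g => letter_val l * g)%g 1%g w.

Definition reduced (w : seq ('I_r * bool)) : bool :=
  sorted (fun l m => m != (l.1, ~~ l.2)) w.

Definition free_generators : Prop :=
  forall g : Gamma, exists! w, reduced w /\ word_val w = g.

Definition word_ball (n : nat) : set Gamma :=
  [set g | exists2 w, (size w <= n)%N & word_val w = g].

End Words.

(** ** Actions *)

Definition is_action (Gamma : groupType) (T : Type)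
    (a : Gamma -> T -> T) : Prop :=
  (forall x, a 1%g x = x) /\ (forall g h x, a (g * h)%g x = a g (a h x)).

Definition measure_preserving_action (R : realType) (Gamma : groupType)
    (d : measure_display) (T : measurableType d) (mu : probability T R)
    (a : Gamma -> T -> T) : Prop :=
  [/\ is_action a,
      forall g, measurable_fun [set: T] (a g) &
      forall g A, measurable A -> mu (a g @^-1` A) = mu A].

(* Automorphisms of a topological group are homeomorphisms: the inverse of
   [b g] is [b g^-1], so continuity of every [b g] suffices. *)
Definition automorphism_action (Gamma : groupType) (G : topologicalGroupType)
    (b : Gamma -> G -> G) : Prop :=
  [/\ is_action b,
      forall g, {morph b g : x y / (x * y)%g} &
      forall g, continuous (b g)].

(* For a countable discrete [Gamma], joint measurability on [Gamma * X] is
   measurability of every [sigma g]. *)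
Definition cocycle (Gamma : groupType) (d : measure_display)
    (X : measurableType d) (G : topologicalGroupType)
    (a : Gamma -> X -> X) (b : Gamma -> G -> G)
    (sigma : Gamma -> X -> G) : Prop :=
  (forall g, measurable_fun [set: X] (sigma g : X -> borel G)) /\
  (forall g h x, sigma (g * h)%g x = (b g (sigma h x) * sigma g (a h x))%g).

Definition skew_product (Gamma : Type) (X : Type) (G : groupType)
    (a : Gamma -> X -> X) (b : Gamma -> G -> G) (sigma : Gamma -> X -> G)
    (g : Gamma) (p : X * G) : X * G :=
  (a g p.1, (b g p.2 * sigma g p.1)%g).

(** ** Standard Borel spaces *)

Definition standard_borel (R : realType) (d : measure_display)
    (X : measurableType d) : Prop :=
  exists Y : completePseudoMetricType R,
    [/\ hausdorff_space Y,
        exists2 D : set Y, countable D & dense D &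
        exists2 f : X -> Y, bijective f &
          @measurable d X = [set f @^-1` B | B in <<s @open Y >>]].

(** ** The f-invariant *)

Section FInvariant.
Context {R : realType} {d : measure_display} {T : measurableType d}.
Implicit Types (mu : probability T R) (P Q : set (set T)).

(* The empty set is allowed as a cell, because it may occur in a join. *)
Definition measurable_partition P : Prop :=
  [/\ countable P, P `<=` measurable, trivIset P id &
      \bigcup_(A in P) A = [set: T]].

(* The summand vanishes when [mu A = 0]. *)
Definition entropy mu P : \bar R :=
  \esum_(A in P) (- (fine (mu A) * ln (fine (mu A))))%:E.

Definition join P Q : set (set T) := [set A `&` B | A in P & B in Q].

Context {Gamma : groupType}.
Implicit Type a : Gamma -> T -> T.

Definition translate a (g : Gamma) P : set (set T) := [set a g @` A | A in P].

(* The join of the partitions [translate a w P], [w] in [W]: its cells are the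
   intersections obtained by choosing one cell [a w @` A w] for every [w]. *)
Definition join_over a (W : set Gamma) P : set (set T) :=
  [set C | exists2 A : Gamma -> set T,
     (forall w, W w -> P (A w)) & C = \bigcap_(w in W) (a w @` A w)].

Definition invariant_sigma_algebra a (S : set (set T)) : Prop :=
  sigma_algebra [set: T] S /\ forall g A, S A -> S (a g @` A).

Definition generating mu a P : Prop :=
  measurable_partition P /\
  forall B, measurable B ->
    exists2 A, smallest (invariant_sigma_algebra a) P A & mu (A `+` B) = 0%E.

Definition finite_entropy_generating mu a P : Prop :=
  generating mu a P /\ (entropy mu P < +oo)%E.

Context {r : nat}.
Implicit Type s : 'I_r -> Gamma.

Definition F_partition s mu a P : \bar R :=
  ((1 - 2 * r%:R)%:E * entropy mu P
   + \sum_(i < r) entropy mu (join P (translate a (s i) P)))%E.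

Definition f_partition s mu a P : \bar R :=
  ereal_inf
    [set F_partition s mu a (join_over a (word_ball s n) P) | n in
       [set n | (0 < n)%N]].

(* The common value of [f_partition] over all finite-entropy generating
   partitions; unspecified when there is no such partition. *)
Definition f_invariant s mu a : \bar R :=
  get [set v | (exists P, finite_entropy_generating mu a P) /\
               forall P, finite_entropy_generating mu a P ->
                 f_partition s mu a P = v].

End FInvariant.

(* Main.v *)
(* The f-invariant is independent of the generating partition: if [t] is a
   letter and [p] refines [q], then [F (p v t q) <= F p], because among the
   [2r] new conditional entropies the one along [t] vanishes.  Hence [F] is
   nonincreasing along the partitions [p^B(n)].  Moreover
   [F (p v q) <= F p + H(q | p)] and [F p <= F (p v q) + 2r H(q | p)], while
   [H(q | p^B(n)) -> 0] when [p] is generating.  For generating [p], [q] one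
   passes from [p^B(n)] to [p^B(k)], then to [p^B(k) v q] at small cost, then
   splits to [p^B(k) v q^B(m)] for free, and finally drops [p^B(k)] at small
   cost.

   For the skew product, let [u] be the lift of a generating partition [p] of
   [X] and [v] the lift of the coset partition [c] of [G]; [u v v] is
   generating.  [F (u^B(m) v v^B(n))] is nonincreasing in [m] and in [n].
   Modulo the finite partition [S] of [X] recording the cosets of finitely many
   values of the cocycle, [v^W] is the lift of [c^W], which is independent
   of the first coordinate; so for fixed [n] the difference to
   [F (p^B(m)) + F (c^B(n))] is controlled by [H(S | p^B(m)) -> 0].
   Taking infima gives the formula. *)
Require Import Defs.
From HB Require Import structures.
From mathcomp Require Import all_boot all_order all_algebra.
From mathcomp Require Import all_classical all_reals all_analysis.
From mathcomp Require Import measurable_realfun.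
From mathcomp Require Import ring lra zify.

Set Implicit Arguments.
Unset Strict Implicit.
Unset Printing Implicit Defensive.

Import Order.TTheory GRing.Theory Num.Theory.

Local Open Scope classical_set_scope.
Local Open Scope ring_scope.

(** * Entropy of countable labellings *)

(** Labelling points by natural numbers turns refinement into an implication between equalities of
    labels and makes empty cells disappear. The inequalities for conditional entropy then come from
    strong subadditivity, which rests on ln t <= t - 1. The limit H(q | p^B(n)) -> 0 needs no
    martingales: the sets approximable in measure by unions of cells of some p^B(n) form an
    invariant sigma-algebra, and [q] is determined, up to small conditional entropy, by finitely
    many sets. Two obstacles belong to the skew product. It preserves the product measure because
    Haar measure is invariant under right translations and automorphisms; both are deduced from left
    invariance by one Fubini argument. And the projection to [G] is not equivariant: one obtains the
    sets depending on the first coordinate, then uses them to undo the cocycle modulo [N], which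
    normality permits. Finite index of [N] makes the partition recording cocycle values finite, so
    that its conditional entropy tends to zero. *)

Definition refines (T I J : Type) (p : T -> I) (q : T -> J) :=
  forall x y, p x = p y -> q x = q y.

Lemma refines_factor (T I J : Type) (j0 : J) (p : T -> I) (q : T -> J) :
  refines p q -> exists f : I -> J, q = f \o p.
Proof.
move=> pq.
have ex i : exists j, forall x, p x = i -> q x = j.
  have [[x <-]|nx] := pselect (exists x, p x = i).
    by exists (q x) => y /pq.
  by exists j0 => x pxi; exfalso; apply: nx; exists x.
have [f fP] := choice ex.
by exists f; apply/funext => x /=; exact: fP.
Qed.

Section LabelEntropy.
Context {R : realType} {d : measure_display} {T : measurableType d}.
Variable mu : probability T R.
Implicit Types z u v w : T -> nat.

Definition mlabel z := forall k, measurable (z @^-1` [set k]).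

Lemma mlabel_preimage z (A : set nat) : mlabel z -> measurable (z @^-1` A).
Proof.
move=> mz; rewrite (_ : z @^-1` A = \bigcup_(k in A) (z @^-1` [set k])).
  by apply: bigcup_measurable => k _; exact: mz.
by apply/seteqP; split => [x Ax|x [k Ak /= zk]]; [exists (z x)|rewrite /= zk].
Qed.

Lemma mlabel_refine z u : mlabel z -> refines z u -> mlabel u.
Proof.
move=> mz /(refines_factor 0%N)[f ->] k.
rewrite [_ @^-1` _](_ : _ = z @^-1` (f @^-1` [set k]))//.
exact: mlabel_preimage.
Qed.

Definition prob z k : R := fine (mu (z @^-1` [set k])).

Lemma prob_ge0 z k : 0 <= prob z k.
Proof. exact: fine_ge0. Qed.

Lemma probE z k : mlabel z -> (prob z k)%:E = mu (z @^-1` [set k]).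
Proof. by move=> mz; rewrite /prob fineK// fin_num_measure. Qed.

Lemma prob_le1 z k : mlabel z -> prob z k <= 1.
Proof. by move=> mz; rewrite -lee_fin probE// probability_le1. Qed.

Lemma integral_mlabel z (phi : nat -> R) : mlabel z -> (forall k, 0 <= phi k) ->
  (\int[mu]_x (phi (z x))%:E = \esum_(k in [set: nat]) (prob z k * phi k)%:E)%E.
Proof.
move=> mz phi0.
have UT : \bigcup_k (z @^-1` [set k]) = [set: T].
  by apply/seteqP; split => // x _; exists (z x).
have mf : measurable_fun [set: T] (fun x => (phi (z x))%:E).
  move=> _ B mB; rewrite setTI.
  rewrite (_ : _ @^-1` _ = z @^-1` ((fun k => (phi k)%:E) @^-1` B))//.
  exact: mlabel_preimage.
rewrite -{1}UT ge0_integral_bigcup//; last 3 first.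
- by rewrite UT.
- by move=> x _; rewrite lee_fin.
- by move=> i j _ _ [x [/= <- <-]].
rewrite -nneseries_esumT; last by move=> k; rewrite lee_fin mulr_ge0// prob_ge0.
apply: eq_eseriesr => k _.
under eq_integral => x.
  rewrite inE /= => ->.
  over.
by rewrite integral_cst// EFinM probE// muleC.
Qed.

(** Both sides are the integral of [phi (f (z x))], so no regrouping of the sum along the fibres of
    [f] is required. *)
Lemma esum_prob_factor z (f : nat -> nat) (phi : nat -> R) : mlabel z ->
  (forall k, 0 <= phi k) ->
  (\esum_(k in [set: nat]) (prob z k * phi (f k))%:E =
   \esum_(k in [set: nat]) (prob (f \o z) k * phi k)%:E)%E.
Proof.
move=> mz phi0; rewrite -integral_mlabel// -(@integral_mlabel (f \o z))//.
by apply: (mlabel_refine mz) => x y /= ->.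
Qed.

Lemma esum_prob z : mlabel z -> (\esum_(k in [set: nat]) (prob z k)%:E = 1)%E.
Proof.
move=> mz; under eq_esum do rewrite -[prob z _]mulr1.
rewrite -(@integral_mlabel z (fun=> 1))// integral_cst// mul1e.
exact: probability_setT.
Qed.

Definition eta (x : R) : R := - (x * ln x).

Lemma eta_ge0 x : x <= 1 -> 0 <= eta x.
Proof.
move=> x1; rewrite /eta oppr_ge0; have [x0|x0] := leP x 0.
  by rewrite ln0// mulr0.
by rewrite pmulr_rle0// ln_le0.
Qed.

Definition label_entropy z : \bar R :=
  \esum_(k in [set: nat]) (eta (prob z k))%:E.

Lemma label_entropy_ge0 z : mlabel z -> (0 <= label_entropy z)%E.
Proof.
by move=> mz; apply: esum_ge0 => k _; rewrite lee_fin eta_ge0// prob_le1.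
Qed.

Lemma prob_factor_ge z (f : nat -> nat) k : mlabel z ->
  prob z k <= prob (f \o z) (f k).
Proof.
move=> mz; have mfz : mlabel (f \o z) by apply: (mlabel_refine mz) => x y /= ->.
rewrite -lee_fin !probE//; apply: le_measure; rewrite ?inE//.
by move=> x /= ->.
Qed.

(** Writing the entropy of a coarser labelling as a sum over the labels of [z] lets the entropies of
    several coarsenings be compared term by term. *)
Lemma label_entropy_factor z (f : nat -> nat) : mlabel z ->
  label_entropy (f \o z) =
  (\esum_(k in [set: nat]) (prob z k * - ln (prob (f \o z) (f k)))%:E)%E.
Proof.
move=> mz; have mfz : mlabel (f \o z) by apply: (mlabel_refine mz) => x y /= ->.
rewrite (@esum_prob_factor z f (fun i => - ln (prob (f \o z) i)))//.
  by apply: eq_esum => k _; rewrite /eta mulrN.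
by move=> k; rewrite oppr_ge0 ln_le0// prob_le1.
Qed.

Lemma label_entropy_le z u : mlabel z -> refines z u ->
  (label_entropy u <= label_entropy z)%E.
Proof.
move=> mz /(refines_factor 0%N)[f ->]; rewrite label_entropy_factor//.
apply: le_esum => k _; rewrite lee_fin /eta -mulrN.
have [->|z0] := eqVneq (prob z k) 0; first by rewrite !mul0r.
have zk : 0 < prob z k by rewrite lt0r z0 prob_ge0.
have ffk := prob_factor_ge f k mz.
by rewrite ler_pM2l// lerN2 ler_ln// posrE// (lt_le_trans zk).
Qed.

(** This is [a] times the inequality ln t <= t - 1 at t = bc/(ea). In the application [a], [b], [c],
    [e] are the masses of corresponding cells of [z], [u], [v], [w]. *)
Lemma mul_ln_submod (a b c e : R) : 0 <= a -> a <= b -> a <= c -> b <= e ->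
  a * - ln a + a * - ln e + a <= a * - ln b + a * - ln c + b * c / e.
Proof.
move=> a0 ab ac be.
have [->|an0] := eqVneq a 0.
  rewrite !mul0r !add0r divr_ge0// ?mulr_ge0//; lra.
have ap : 0 < a by rewrite lt0r an0.
have bp : 0 < b by lra.
have cp : 0 < c by lra.
have ep : 0 < e by lra.
set t := b * c / e / a.
have tp : 0 < t by rewrite !divr_gt0// mulr_gt0.
have lnt : ln t = ln b + ln c - ln e - ln a.
  by rewrite /t !ln_div ?posrE ?divr_gt0 ?mulr_gt0// lnM ?posrE.
have : ln (1 + (t - 1)) <= t - 1 by apply: le_ln1Dx; lra.
rewrite addrC subrK => /(ler_wpM2l a0); rewrite mulrBr mulr1.
rewrite [a * t]mulrC /t divfK// -/t lnt; lra.
Qed.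

(** The summands are masses of the coupling that makes [u] and [v] conditionally independent given
    [w]. Labels of [z] embed into pairs of labels of [u] and [v], and summing over [v] first leaves
    at most the mass of each cell of [u]. *)
Lemma sum_cond_indep_le z u v w (fu fv gu gv : nat -> nat) :
  mlabel z -> (forall x y, u x = u y -> v x = v y -> z x = z y) ->
  u = fu \o z -> v = fv \o z -> w = gu \o u -> w = gv \o v ->
  (\esum_(k in range z)
    (prob u (fu k) * prob v (fv k) / prob w (gu (fu k)))%:E <= 1)%E.
Proof.
move=> mz zuv uE vE wuE wvE.
have mu_ : mlabel u by apply: (mlabel_refine mz) => x y; rewrite uE /= => ->.
have mv : mlabel v by apply: (mlabel_refine mz) => x y; rewrite vE /= => ->.
have mw : mlabel w by apply: (mlabel_refine mu_) => x y; rewrite wuE /= => ->.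
(* The summand is extended to all pairs of labels, by zero where the two labels lie over different
   labels of [w]. *)
pose phi m i := prob u m * (if i == gu m then (prob w (gu m))^-1 else 0).
pose G (p : nat * nat) := (prob v p.2 * phi p.1 (gv p.2))%:E.
have phi_ge0 m i : 0 <= phi m i.
  by rewrite mulr_ge0 ?prob_ge0//; case: ifP => //; rewrite invr_ge0 prob_ge0.
have G_ge0 p : (0 <= G p)%E by rewrite lee_fin mulr_ge0 ?prob_ge0.
pose e k := (fu k, fv k).
have einj : set_inj (range z) e.
  move=> _ _ /set_mem[x _ <-] /set_mem[y _ <-] [eu ev].
  by apply: zuv; rewrite ?uE ?vE.
have -> : (\esum_(k in range z)
    (prob u (fu k) * prob v (fv k) / prob w (gu (fu k)))%:E)%E =
    (\esum_(k in range z) G (e k))%E.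
  apply: eq_esum => _ [x _ <-]; rewrite /G /phi /=; congr EFin.
  have -> : gv (fv (z x)) = w x by rewrite wvE vE.
  have -> : gu (fu (z x)) = w x by rewrite wuE uE.
  by rewrite eqxx; ring.
rewrite -(esum_image _ _ G einj).
apply: (@le_trans _ _ (\esum_(p in [set: nat] `*`` (fun=> [set: nat])) G p)%E).
  rewrite [leLHS]esum_mkcond [leRHS]esum_mkcond; apply: le_esum => p _.
  rewrite [p \in _ `*`` _]mem_set//.
  by case: ifP.
rewrite -(@esum_esum _ _ _ setT (fun=> setT) (fun m m' => G (m, m')))//.
rewrite -(esum_prob mu_); apply: le_esum => m _; rewrite /G /=.
rewrite esum_prob_factor// -wvE.
rewrite (_ : (\esum_(k in _) _)%E =
  \esum_(k in [set gu m]) (prob w k * phi m k)%:E); last first.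
  rewrite [RHS]esum_mkcond; apply: eq_esum => k _.
  rewrite /phi; have [->|kn] := eqVneq k (gu m); first by rewrite mem_set.
  by rewrite memNset ?mulr0//; apply/eqP.
rewrite esum_set1 ?lee_fin; last by rewrite mulr_ge0 ?prob_ge0.
rewrite /phi eqxx mulrCA.
have [->|w0] := eqVneq (prob w (gu m)) 0; first by rewrite mul0r mulr0 prob_ge0.
by rewrite divff// mulr1.
Qed.

(** Strong subadditivity, that is, nonnegativity of the conditional mutual information of [u] and
    [v] given [w]. Entropies may be infinite here, so nothing is subtracted. *)
Lemma label_entropy_submod z u v w : mlabel z ->
  refines z u -> refines z v -> refines u w -> refines v w ->
  (forall x y, u x = u y -> v x = v y -> z x = z y) ->
  (label_entropy z + label_entropy w <= label_entropy u + label_entropy v)%E.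
Proof.
move=> mz zu zv uw vw zuv.
have mu_ := mlabel_refine mz zu.
have mv := mlabel_refine mz zv.
have mw := mlabel_refine mu_ uw.
have [fu uE] := refines_factor 0%N zu.
have [fv vE] := refines_factor 0%N zv.
have [gu wuE] := refines_factor 0%N uw.
have [gv wvE] := refines_factor 0%N vw.
have uze := label_entropy_factor fu mz; rewrite -uE in uze.
have vze := label_entropy_factor fv mz; rewrite -vE in vze.
have wze := label_entropy_factor (gu \o fu) mz.
rewrite -compA -uE -wuE in wze.
have zze : label_entropy z =
    (\esum_(k in [set: nat]) (prob z k * - ln (prob z k))%:E)%E.
  by apply: eq_esum => k _; rewrite /eta mulrN.
have t0 (y : T -> nat) a i : mlabel y -> 0 <= a -> 0 <= a * - ln (prob y i).
  by move=> my a0; rewrite mulr_ge0// oppr_ge0 ln_le0// prob_le1.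
pose A := range z.
(* The added 1 on the left is the total mass of [z]; on the right it bounds the mass of the
   conditionally independent coupling. *)
have key : (label_entropy z + label_entropy w + 1 <=
            label_entropy u + label_entropy v + 1)%E.
  apply: (@le_trans _ _ (label_entropy u + label_entropy v +
    \esum_(k in A)
      (prob u (fu k) * prob v (fv k) / prob w (gu (fu k)))%:E)%E); last first.
    by apply: leeD => //; exact: (sum_cond_indep_le mz zuv uE vE wuE wvE).
  rewrite zze wze uze vze -(esum_prob mz) [X in (_ <= _ + X)%E]esum_mkcond.
  rewrite -!esumD; try by move=> k _ /=;
    rewrite ?lee_fin ?addr_ge0 ?t0 ?prob_ge0//; case: ifP => // _;
    rewrite lee_fin mulr_ge0 ?invr_ge0 ?mulr_ge0 ?prob_ge0.
  apply: le_esum => k _ /=; case: ifPn => [/set_mem[x _ zk]|kA].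
    rewrite -!EFinD lee_fin; apply: mul_ln_submod; first exact: prob_ge0.
    - by rewrite uE; exact: prob_factor_ge.
    - by rewrite vE; exact: prob_factor_ge.
    - by rewrite wuE; exact: prob_factor_ge.
  have -> : prob z k = 0.
    apply/EFin_inj; rewrite probE// (_ : _ @^-1` _ = set0) ?measure0//.
    apply/seteqP; split => // x /= zk; move/negP: kA; apply.
    by rewrite inE; exists x.
  by rewrite !mul0r -!EFinD !addr0.
by rewrite leeD2rE in key.
Qed.

End LabelEntropy.

(** * Conditional entropy *)

Section FinitePartitions.
Context {R : realType} {d : measure_display} {T : measurableType d}.
Variable mu : probability T R.

(* A countable partition is represented by a labelling of its points; two
   labellings give the same partition when they refine each other. *)
Record fpart := FPart {
  label :> T -> nat ;
  measurable_label : mlabel label ;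
  label_entropy_lty : (label_entropy mu label < +oo)%E }.

Implicit Types p q u v : fpart.

Definition h p : R := fine (label_entropy mu p).

Lemma hE p : (h p)%:E = label_entropy mu p.
Proof.
rewrite /h fineK// ge0_fin_numE; first exact: label_entropy_lty.
exact/label_entropy_ge0/measurable_label.
Qed.

Lemma h_le p q : refines p q -> h q <= h p.
Proof.
move=> pq; rewrite -lee_fin !hE label_entropy_le//; exact: measurable_label.
Qed.

Lemma h_eq p q : refines p q -> refines q p -> h p = h q.
Proof. by move=> pq qp; apply/eqP; rewrite eq_le !h_le. Qed.

Lemma coarsen_lty p (f : T -> nat) : refines p f ->
  (label_entropy mu f < +oo)%E.
Proof.
move=> pf; apply: le_lt_trans (label_entropy_lty p).
exact/label_entropy_le/pf/measurable_label.
Qed.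

Definition coarsen p (f : T -> nat) (pf : refines p f) : fpart :=
  FPart (mlabel_refine (measurable_label p) pf) (coarsen_lty pf).

Lemma mlabel_cst k : mlabel (fun _ : T => k).
Proof.
move=> j; have [->|kj] := eqVneq k j.
  rewrite (_ : _ @^-1` _ = setT)//.
  by apply/seteqP; split.
rewrite (_ : _ @^-1` _ = set0)//.
by apply/seteqP; split => // x /= /eqP; rewrite (negbTE kj).
Qed.

Lemma label_entropy_cst k : label_entropy mu (fun=> k) = 0%E.
Proof.
apply: esum1 => j _; rewrite /prob; have [->|kj] := eqVneq k j.
  rewrite (_ : _ @^-1` _ = setT); last by apply/seteqP; split.
  by rewrite probability_setT /eta ln1 mulr0 oppr0.
rewrite (_ : _ @^-1` _ = set0) ?measure0 /eta ?mul0r ?oppr0//.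
by apply/seteqP; split => // x /= /eqP; rewrite (negbTE kj).
Qed.

Lemma cst_lty k : (label_entropy mu (fun=> k) < +oo)%E.
Proof. by rewrite label_entropy_cst. Qed.

Definition fpart1 : fpart := FPart (@mlabel_cst 0%N) (@cst_lty 0%N).

Lemma h_fpart1 : h fpart1 = 0.
Proof. by apply: EFin_inj; rewrite hE label_entropy_cst. Qed.

Definition pair_label (I J : countType) (p : T -> I) (q : T -> J) x : nat :=
  pickle (p x, q x).

Lemma pair_labelE (I J : countType) (p : T -> I) (q : T -> J) x y :
  pair_label p q x = pair_label p q y <-> p x = p y /\ q x = q y.
Proof.
by split=> [/(pcan_inj (@pickleK _))[]//|[e1 e2]]; rewrite /pair_label e1 e2.
Qed.

Lemma mlabel_pair (p q : T -> nat) :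
  mlabel p -> mlabel q -> mlabel (pair_label p q).
Proof.
move=> mp mq k; have [[x xk]|nx] := pselect (exists x, pair_label p q x = k).
  rewrite (_ : _ @^-1` _ = p @^-1` [set p x] `&` q @^-1` [set q x]).
    exact: measurableI.
  apply/seteqP; split => y /=; first by rewrite -xk => /pair_labelE.
  by rewrite -xk => ?; apply/pair_labelE.
rewrite (_ : _ @^-1` _ = set0)//.
by apply/seteqP; split => // x /= xk; apply: nx; exists x.
Qed.

(** Submodularity over the one-cell partition is ordinary subadditivity. *)
Lemma pair_lty p q : (label_entropy mu (pair_label p q) < +oo)%E.
Proof.
have mp := measurable_label p; have mq := measurable_label q.
have := @label_entropy_submod _ _ _ mu (pair_label p q) p q (fun=> 0%N).
move=> /(_ (mlabel_pair mp mq)).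
rewrite label_entropy_cst adde0 => H; apply: (le_lt_trans (H _ _ _ _ _)) => //.
- by move=> x y /pair_labelE[].
- by move=> x y /pair_labelE[].
- by move=> x y ? ?; apply/pair_labelE.
- by rewrite -!hE ltry.
Qed.

Definition vee p q : fpart :=
  FPart (mlabel_pair (measurable_label p) (measurable_label q)) (pair_lty p q).

Lemma veeE p q x y : vee p q x = vee p q y <-> p x = p y /\ q x = q y.
Proof. exact: pair_labelE. Qed.

(** It suffices that [p] be determined by [u] and [v] jointly. Monotonicity of conditional entropy
    in both arguments is an instance. *)
Lemma h_submod p q u v : refines u q -> refines v q ->
  (forall x y, u x = u y -> v x = v y -> p x = p y) ->
  h p + h q <= h u + h v.
Proof.
move=> uq vq uvp; pose z := vee u v.
have zp : refines z p by move=> x y /veeE[/uvp]; apply.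
suff: h z + h q <= h u + h v by have := h_le zp; lra.
rewrite -lee_fin !EFinD !hE; apply: label_entropy_submod => //.
- exact: measurable_label.
- by move=> x y /veeE[].
- by move=> x y /veeE[].
- by move=> x y ? ?; apply/veeE.
Qed.

(* The conditional entropy [H(q | p)]. *)
Definition hc q p : R := h (vee p q) - h p.

Lemma hc_ge0 q p : 0 <= hc q p.
Proof. by rewrite subr_ge0 h_le// => x y /veeE[]. Qed.

Lemma hc_refines q p u v : refines u p -> refines q v -> hc v u <= hc q p.
Proof.
move=> up qv; suff: h (vee u v) + h p <= h u + h (vee p q) by rewrite /hc; lra.
apply: h_submod => //.
- by move=> x y /veeE[].
- by move=> x y uxy /veeE[_ /qv ?]; apply/veeE.
Qed.

Lemma hc_eq0 q p : refines p q -> hc q p = 0.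
Proof.
move=> pq; rewrite /hc (@h_eq (vee p q) p) ?subrr//.
- by move=> x y /veeE[].
- by move=> x y pxy; apply/veeE; split => //; exact: pq.
Qed.

Lemma hc_le_h q p : hc q p <= h q.
Proof.
rewrite (le_trans (@hc_refines q fpart1 p q _ _))//.
by rewrite /hc h_fpart1 subr0 h_le// => x y ?; apply/veeE.
Qed.

Lemma hc_vee q u p : hc (vee q u) p = hc q p + hc u (vee p q).
Proof.
rewrite /hc (@h_eq (vee p (vee q u)) (vee (vee p q) u)); first by ring.
- by move=> x y /veeE[? /veeE[? ?]]; apply/veeE; split => //; apply/veeE.
- by move=> x y /veeE[/veeE[? ?] ?]; apply/veeE; split => //; apply/veeE.
Qed.

Lemma hc_vee_le q u p : hc (vee q u) p <= hc q p + hc u p.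
Proof. by rewrite hc_vee lerD2l hc_refines// => x y /veeE[]. Qed.

Lemma hc_chain q u p : hc q p <= hc q u + hc u p.
Proof.
apply: (@le_trans _ _ (hc (vee u q) p)).
  by apply: hc_refines => // x y /veeE[].
by rewrite hc_vee addrC lerD2r hc_refines// => x y /veeE[].
Qed.

Lemma h_vee p q : h (vee p q) = h p + hc q p.
Proof. rewrite /hc; ring. Qed.

End FinitePartitions.

(** * Pulling partitions back along measure-preserving maps *)

Section Pullback.
Context {R : realType} {d d' : measure_display}.
Context {T : measurableType d} {T' : measurableType d'}.
Variables (mu : probability T R) (mu' : probability T' R).

Definition measure_preserving (f : T -> T') :=
  forall A, measurable A -> measurable (f @^-1` A) /\ mu (f @^-1` A) = mu' A.

Variables (f : T -> T') (mf : measure_preserving f).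

Lemma mlabel_pull (p : fpart mu') : mlabel (p \o f).
Proof. by move=> k; apply: (mf (measurable_label p k)).1. Qed.

Lemma label_entropy_pull (p : fpart mu') :
  label_entropy mu (p \o f) = label_entropy mu' p.
Proof.
apply: eq_esum => k _; rewrite /prob.
by rewrite -(mf (measurable_label p k)).2.
Qed.

Lemma pull_lty (p : fpart mu') : (label_entropy mu (p \o f) < +oo)%E.
Proof. by rewrite label_entropy_pull; exact: label_entropy_lty. Qed.

Definition pull (p : fpart mu') : fpart mu :=
  FPart (@mlabel_pull p) (pull_lty p).

Lemma h_pull p : h (pull p) = h p.
Proof. by rewrite /h label_entropy_pull. Qed.

Lemma hc_pull p q : hc (pull q) (pull p) = hc q p.
Proof.
by rewrite /hc h_pull -(h_pull (vee p q)) (@h_eq _ _ _ _ _ (pull (vee p q))).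
Qed.

End Pullback.

(** * The functional F of an action *)

Section Action.
Context {R : realType} {d : measure_display} {T : measurableType d}.
Context {Gamma : groupType} {r : nat}.
Variables (mu : probability T R) (s : 'I_r -> Gamma) (a : Gamma -> T -> T).
Hypothesis ha : measure_preserving_action mu a.

Implicit Types (p q u : fpart mu) (g : Gamma) (W : seq Gamma).

Lemma act1 x : a 1%g x = x. Proof. by case: ha => -[]. Qed.
Lemma actM g g' x : a (g * g')%g x = a g (a g' x).
Proof. by case: ha => -[]. Qed.
Lemma actVK g : cancel (a g^-1%g) (a g).
Proof. by move=> x; rewrite -actM mulgV act1. Qed.
Lemma actK g : cancel (a g) (a g^-1%g).
Proof. by move=> x; rewrite -actM mulVg act1. Qed.

Lemma act_image g (A : set T) : a g @` A = a g^-1%g @^-1` A.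
Proof.
apply/seteqP; split => [_ [x Ax <-]|x Ax] /=; first by rewrite actK.
by exists (a g^-1%g x) => //; rewrite actVK.
Qed.

Lemma act_measure_preserving g : measure_preserving mu mu (a g).
Proof.
case: ha => _ ma pa A mA; split; last exact: pa.
by rewrite -[_ @^-1` _]setTI; exact: ma.
Qed.

(** The label of the translate at a point is the label of [p] at its image under the inverse of [g],
    because the image of a cell under [a g] is a preimage under [a g^-1]. *)
Definition tshift g p : fpart mu := pull (act_measure_preserving g^-1%g) p.

Lemma hc_shift g p q : hc (tshift g p) (tshift g q) = hc p q.
Proof. exact: hc_pull. Qed.

Lemma shiftM g g' p x : tshift (g * g')%g p x = tshift g (tshift g' p) x.
Proof. by rewrite /tshift /= invgM actM. Qed.

Definition F_label p : R :=
  (1 - 2 * r%:R) * h p + \sum_(i < r) h (vee p (tshift (s i) p)).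

Lemma F_eq p q : refines p q -> refines q p -> F_label p = F_label q.
Proof.
move=> pq qp; rewrite /F_label (h_eq pq qp); congr (_ + _); apply: eq_bigr => i _.
by apply: h_eq => x y /veeE[? ?]; apply/veeE; split;
  [exact: pq|exact: pq|exact: qp|exact: qp].
Qed.

Lemma h_vee_shift_le p q g :
  h (vee (vee p q) (tshift g (vee p q))) <=
  h (vee p (tshift g p)) + hc q (vee p (tshift g p)) +
  hc (tshift g q) (vee p (tshift g p)).
Proof.
set v := vee p (tshift g p).
rewrite (@h_eq _ _ _ _ _ (vee v (vee q (tshift g q)))); last 2 first.
- by move=> x y /veeE[/veeE[? ?] /veeE[? ?]];
    apply/veeE; split; apply/veeE; split.
- by move=> x y /veeE[/veeE[? ?] /veeE[? ?]];
    apply/veeE; split; apply/veeE; split.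
by rewrite h_vee -addrA lerD2l hc_vee_le.
Qed.

(** Each of the [r] joins grows by at most 2H(q | p), and the first term changes by (1 - 2r)H(q |
    p); the total is H(q | p). *)
Lemma F_vee_le p q : F_label (vee p q) <= F_label p + hc q p.
Proof.
rewrite /F_label h_vee.
have Hi i : h (vee (vee p q) (tshift (s i) (vee p q))) <=
    h (vee p (tshift (s i) p)) + 2 * hc q p.
  apply: (le_trans (h_vee_shift_le _ _ _)).
  rewrite -addrA lerD2l mulr_natl mulr2n lerD//.
    by apply: hc_refines => // x y /veeE[].
  rewrite -[leRHS](hc_shift (s i)).
  by apply: hc_refines => // x y /veeE[].
have := @ler_sum _ _ (index_enum _) xpredT _ _ (fun i _ => Hi i).
rewrite big_split /= sumr_const card_ord -mulr_natr; lra.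
Qed.

(** The joins can only grow, so the sole loss comes from the negative part of the coefficient 1 -
    2r. *)
Lemma F_le_vee p q : F_label p <= F_label (vee p q) + 2 * r%:R * hc q p.
Proof.
rewrite /F_label h_vee.
have Hi i : h (vee p (tshift (s i) p)) <=
    h (vee (vee p q) (tshift (s i) (vee p q))).
  by apply: h_le => x y /veeE[/veeE[? ?] /veeE[? ?]]; apply/veeE; split.
have := @ler_sum _ _ (index_enum _) xpredT _ _ (fun i _ => Hi i).
have := hc_ge0 q p; lra.
Qed.

(* Of the [2r] conditional entropies created by adding a translate of [q] by
   a letter, the one along that letter vanishes. *)
Lemma F_split_le p q l : refines p q ->
  F_label (vee p (tshift (letter_val s l) q)) <= F_label p.
Proof.
move=> pq; set q' := tshift _ q; rewrite /F_label h_vee.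
(* The weights sum to 2r - 1 over all [i], which the coefficient 1 - 2r of [h] cancels exactly. *)
have Hi i : h (vee (vee p q') (tshift (s i) (vee p q'))) <=
    h (vee p (tshift (s i) p)) + (2 - (i == l.1)%:R) * hc q' p.
  apply: (le_trans (h_vee_shift_le _ _ _)).
  rewrite -addrA lerD2l.
  have H1 : hc q' (vee p (tshift (s i) p)) <= hc q' p.
    by apply: hc_refines => // x y /veeE[].
  have H2 : hc (tshift (s i) q') (vee p (tshift (s i) p)) <= hc q' p.
    rewrite -[leRHS](hc_shift (s i)).
    by apply: hc_refines => // x y /veeE[].
  have [il|_] := eqVneq i l.1; last by rewrite mulr0n; lra.
  (* For an inverse letter, translating [q'] by [s i] gives back [q], which is coarser than [p]; for
     a positive letter, [q'] is coarser than the translate of [p]. *)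
  rewrite mulr1n; case: l @q' il H1 H2 => j [] q' /= il H1 H2.
    rewrite [X in _ + X]hc_eq0; first by lra.
    move=> x y /veeE[/pq pxy _]; rewrite /q' /= /letter_val /= -il.
    by rewrite invgK !actVK.
  rewrite [X in X + _]hc_eq0; first by lra.
  by move=> x y /veeE[_]; rewrite /q' /= /letter_val /= -il => /pq.
have := @ler_sum _ _ (index_enum _) xpredT _ _ (fun i _ => Hi i).
rewrite big_split /= -mulr_suml sumrB sumr_const card_ord.
have -> : \sum_(i < r) (i == l.1)%:R = 1 :> R.
  by rewrite (bigD1 l.1)//= eqxx big1 ?addr0// => i /negPf ->.
rewrite -mulr_natr; lra.
Qed.

Definition vee_over W p : fpart mu :=
  foldr (fun w acc => vee (tshift w p) acc) (fpart1 mu) W.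

Lemma vee_overE W p x y : vee_over W p x = vee_over W p y <->
  forall w, w \in W -> p (a w^-1%g x) = p (a w^-1%g y).
Proof.
elim: W => [|w W IH]; first by split.
rewrite -[vee_over (w :: W) p]/(vee (tshift w p) (vee_over W p)) veeE IH.
split => [[e1 e2] w'|H]; first by rewrite inE => /predU1P[->|/e2].
by split => [|w' w'W]; apply: H; rewrite inE ?eqxx ?w'W ?orbT.
Qed.

(** Repetitions are harmless for joins. Every element put in front is a letter times an element of
    the preceding ball, which is the form that one-letter splittings require. *)
Fixpoint ball_seq n : seq Gamma :=
  if n is n'.+1 then
    [seq (letter_val s l * g)%g | l <- enum {: 'I_r * bool}, g <- ball_seq n']
      ++ ball_seq n'
  else [:: 1%g].

Lemma mem_ball_seq n g : (g \in ball_seq n) <-> word_ball s n g.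
Proof.
elim: n g => [|n IH] g /=.
  rewrite inE; split => [/eqP ->|[[|//] _ <-//]]; first by exists [::].
rewrite mem_cat; split.
  move=> /orP[/allpairsP[[l g'] [_ /IH[w wn wg] ->]]|/IH[w wn wg]].
    by exists (l :: w) => //=; rewrite wg.
  by exists w => //; exact: leqW.
move=> [[|l w] /= wn <-].
  by apply/orP; right; apply/IH; exists [::].
apply/orP; left; apply/allpairsP; exists (l, word_val s w); split => //=.
  by rewrite mem_enum.
by apply/IH; exists w.
Qed.

Definition vee_ball n p := vee_over (ball_seq n) p.

Lemma vee_ballE n p x y : vee_ball n p x = vee_ball n p y <->
  forall w, word_ball s n w -> p (a w^-1%g x) = p (a w^-1%g y).
Proof. by rewrite vee_overE; split => H w /mem_ball_seq; exact: H. Qed.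

Lemma word_ball1 n : word_ball s n 1%g. Proof. by exists [::]. Qed.

Lemma word_ball_le m n : (m <= n)%N -> word_ball s m `<=` word_ball s n.
Proof. by move=> mn g [w wm wg]; exists w => //; exact: leq_trans mn. Qed.

Lemma refines_ball_le m n p : (m <= n)%N ->
  refines (vee_ball n p) (vee_ball m p).
Proof.
move=> mn x y /vee_ballE H; apply/vee_ballE => w /(word_ball_le mn); exact: H.
Qed.

Lemma refines_ball n p : refines (vee_ball n p) p.
Proof.
by move=> x y /vee_ballE/(_ _ (word_ball1 n)); rewrite invg1 !act1.
Qed.

(** The translates are added one at a time; each is a letter applied to a translate that the current
    partition already refines, so every step is a splitting. *)
Lemma F_vee_vee_over_le p q (L : seq (('I_r * bool) * Gamma)) W :
  (forall lg, lg \in L -> lg.2 \in W) ->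
  F_label (vee p (vee_over ([seq (letter_val s lg.1 * lg.2)%g | lg <- L] ++ W) q)) <=
  F_label (vee p (vee_over W q)).
Proof.
elim: L => [//|[l g] L IH] LW /=.
have {}IH := IH (fun lg lgL => LW lg (@mem_behead _ ((l, g) :: L) lg lgL)).
set V := _ ++ W in IH *.
have gV : g \in V.
  by rewrite mem_cat (LW (l, g)) ?orbT// mem_head.
apply: le_trans IH.
rewrite (@F_eq _ (vee (vee p (vee_over V q)) (tshift (letter_val s l) (tshift g q)))).
- by apply: F_split_le => x y /veeE[_ /vee_overE]; apply.
- move=> x y /veeE[? /veeE[e ?]]; apply/veeE; split; first exact/veeE.
  by rewrite -!shiftM.
- move=> x y /veeE[/veeE[? ?] e]; apply/veeE; split => //; apply/veeE; split => //.
  by rewrite !shiftM.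
Qed.

Lemma F_vee_ball_le n p q : refines p q ->
  F_label (vee p (vee_ball n q)) <= F_label p.
Proof.
move=> pq; elim: n => [|n IH].
  rewrite (@F_eq _ p)//; first by move=> x y /veeE[].
  move=> x y pxy; apply/veeE; split => //; apply/vee_overE => w.
  by rewrite inE => /eqP ->; rewrite invg1 !act1; exact: pq.
apply: le_trans IH; rewrite /vee_ball /=.
rewrite (_ : [seq _ | l <- _, g <- _] = [seq (letter_val s lg.1 * lg.2)%g |
  lg <- [seq (l, g) | l <- enum {: 'I_r * bool}, g <- ball_seq n]]).
  by apply: F_vee_vee_over_le => lg /allpairsP[[l g] [_ gV ->]].
by rewrite map_allpairs.
Qed.

Lemma F_ball_le m n p : (m <= n)%N ->
  F_label (vee_ball n p) <= F_label (vee_ball m p).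
Proof.
move=> mn; apply: le_trans (F_vee_ball_le n (@refines_ball m p)).
rewrite (@F_eq _ (vee (vee_ball m p) (vee_ball n p)))//.
  by move=> x y e; apply/veeE; split => //; exact: refines_ball_le e.
by move=> x y /veeE[].
Qed.

End Action.

(** * Approximation of sets in measure *)

Section RealMeasure.
Context {R : realType} {d : measure_display} {T : measurableType d}.
Variable mu : probability T R.
Implicit Types A B C D : set T.

Definition pmu A : R := fine (mu A).

Lemma pmuE A : measurable A -> (pmu A)%:E = mu A.
Proof. by move=> mA; rewrite /pmu fineK// fin_num_measure. Qed.

Lemma pmu_leU A B C : measurable A -> measurable B -> measurable C ->
  A `<=` B `|` C -> pmu A <= pmu B + pmu C.
Proof.
move=> mA mB mC ABC; rewrite -lee_fin EFinD !pmuE//.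
apply: (@le_trans _ _ (mu (B `|` C))); last exact: measureU2.
by rewrite le_measure ?inE//; exact: measurableU.
Qed.

Lemma measurable_setY A B : measurable A -> measurable B ->
  measurable (A `+` B).
Proof. by move=> mA mB; apply: measurableU; exact: measurableD. Qed.

Lemma pmu_setY_trans B A C : measurable A -> measurable B -> measurable C ->
  pmu (A `+` C) <= pmu (A `+` B) + pmu (B `+` C).
Proof.
move=> mA mB mC; apply: pmu_leU; do ?exact: measurable_setY.
by move=> x /=; have [] := pselect (B x); tauto.
Qed.

Lemma bigcup_approx (A : (set T)^nat) (e : R) : (forall n, measurable (A n)) ->
  0 < e -> exists n, pmu ((\bigcup_k A k) `+` (\bigcup_(k < n) A k)) <= e.
Proof.
move=> mA e0; set U := \bigcup_k A k; pose B n := \bigcup_(k < n) A k.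
have mB n : measurable (B n) by apply: bigcup_measurable.
have mU : measurable U by apply: bigcupT_measurable.
have BU : \bigcup_n B n = U.
  apply/seteqP; split => [x [n _ [k _ Akx]]|x [k _ Akx]]; first by exists k.
  by exists k.+1 => //; exists k => //=.
have : mu \o B @ \oo --> mu U.
  rewrite -BU; apply: nondecreasing_cvg_mu => //; first by rewrite BU.
  move=> m n mn; apply/subsetPset => x [k /= km Akx]; exists k => //=.
  exact: leq_trans mn.
rewrite -(pmuE mU) => /fine_cvgP[_ /cvgrPdist_le /(_ e e0)[n _ /(_ n)]].
move=> /(_ (leqnn n)) /= H; exists n; apply: le_trans H.
apply: le_trans (ler_norm _); rewrite -/(pmu _) lerBrDr -lee_fin EFinD !pmuE//.
  rewrite -measureU//.
  - rewrite le_measure ?inE//.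
      by apply: (measurableU _ (B n)) => //; apply: measurable_setY => //; exact: (mB n).
    have BnU x : B n x -> U x by move=> [k _ ?]; exists k.
    by move=> x /= [[[]|[/BnU]]|/BnU].
  - by apply: measurable_setY => //; exact: (mB n).
  - apply/seteqP; split => // x /= [[[]|[]] + + Bx] => [_|Bx' nU]; first by apply.
    by apply: nU; case: Bx => k _ ?; exists k.
by apply: measurable_setY => //; exact: (mB n).
Qed.

End RealMeasure.

(** * Conditional entropy along a generating partition *)

Section Indicators.
Context {R : realType} {d : measure_display} {T : measurableType d}.
Variable mu : probability T R.
Implicit Types (A B : set T) (q : fpart mu).

(** With x = t^2 the claim follows from ln(1/t) <= 1/t - 1. It gives an explicit modulus for the
    vanishing of [eta] at 0. *)
Lemma eta_le_sqrt (x : R) : 0 <= x -> eta x <= 2 * Num.sqrt x.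
Proof.
rewrite le_eqVlt => /predU1P[<-|x0]; first by rewrite /eta mul0r oppr0 sqrtr0 mulr0.
set t := Num.sqrt x; have t0 : 0 < t by rewrite sqrtr_gt0.
have -> : x = t ^+ 2 by rewrite sqr_sqrtr// ltW.
rewrite /eta lnXn// -[ln t *+ 2]mulr_natl -mulrN.
have : ln (1 + (t^-1 - 1)) <= t^-1 - 1.
  by apply: le_ln1Dx; rewrite ltrBrDl addrN invr_gt0.
rewrite addrC subrK lnV ?posrE// => lnt.
have : t ^+ 2 * - (2 * ln t) <= t ^+ 2 * (2 * (t^-1 - 1)).
  by rewrite ler_wpM2l ?sqr_ge0//; lra.
move/le_trans; apply; rewrite expr2.
have -> : t * t * (2 * (t^-1 - 1)) = 2 * t * (t * t^-1) - 2 * t * t by ring.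
rewrite divff ?gt_eqF//; nra.
Qed.

Lemma eta_1B_le (x : R) : 0 <= x -> x <= 1 -> eta (1 - x) <= x.
Proof.
move=> x0; rewrite le_eqVlt => /predU1P[->|x1].
  by rewrite subrr /eta mul0r oppr0.
set t := 1 - x; have t0 : 0 < t by rewrite /t; lra.
have : ln (1 + (t^-1 - 1)) <= t^-1 - 1.
  by apply: le_ln1Dx; rewrite ltrBrDl addrN invr_gt0.
rewrite addrC subrK lnV ?posrE// => /(ler_wpM2l (ltW t0)).
rewrite mulrBr divff ?gt_eqF// mulr1 /eta -mulrN /t; lra.
Qed.

Lemma esum_bounded (f : nat -> R) n : (forall k, (n <= k)%N -> f k = 0) ->
  (forall k, 0 <= f k) ->
  (\esum_(k in [set: nat]) (f k)%:E = (\sum_(0 <= k < n) f k)%:E)%E.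
Proof.
move=> fn f0; rewrite -nneseries_esumT; last by move=> k; rewrite lee_fin.
rewrite (@nneseries_split _ _ 0 n); last by move=> k _; rewrite lee_fin.
rewrite add0n eseries0 ?adde0 ?sumEFin// => k nk _.
by rewrite fn.
Qed.

Lemma bounded_lty (z : T -> nat) n : mlabel z -> (forall x, (z x < n)%N) ->
  (label_entropy mu z < +oo)%E.
Proof.
move=> mz zn; rewrite /label_entropy (@esum_bounded _ n) ?ltry//.
- move=> k nk; rewrite /prob (_ : _ @^-1` _ = set0) ?measure0.
    by rewrite /eta mul0r oppr0.
  apply/seteqP; split => // x /= zk; move: (zn x).
  by rewrite zk ltnNge nk.
- by move=> k; rewrite eta_ge0// prob_le1.
Qed.

Definition ind_label A (x : T) : nat := `[< A x >].

Lemma ind_labelE A x y : ind_label A x = ind_label A y <-> (A x <-> A y).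
Proof.
rewrite /ind_label; split => [|e]; last by rewrite (asbool_equiv_eq e).
by case: asboolP; case: asboolP => // ? ? _.
Qed.

Lemma ind_label1 A : ind_label A @^-1` [set 1%N] = A.
Proof.
by apply/seteqP; split => x; rewrite /= /ind_label; case: asboolP.
Qed.

Lemma ind_label0 A : ind_label A @^-1` [set 0%N] = ~` A.
Proof.
by apply/seteqP; split => x; rewrite /= /ind_label; case: asboolP.
Qed.

Lemma mlabel_ind A : measurable A -> mlabel (ind_label A).
Proof.
move=> mA [|[|k]]; rewrite ?ind_label0 ?ind_label1//; first exact: measurableC.
rewrite (_ : _ @^-1` _ = set0)//.
by apply/seteqP; split => x; rewrite /= /ind_label; case: asboolP.
Qed.

Lemma ind_lt2 A x : (ind_label A x < 2)%N.
Proof. by rewrite /ind_label; case: asboolP. Qed.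

Definition ind A (mA : measurable A) : fpart mu :=
  FPart (mlabel_ind mA) (bounded_lty (mlabel_ind mA) (@ind_lt2 A)).

(** The constant is 2 + 1: the set contributes at most 2 sqrt x and its complement at most x <= sqrt
    x. *)
Lemma h_ind_le A (mA : measurable A) : h (ind mA) <= 3 * Num.sqrt (pmu mu A).
Proof.
set x := pmu mu A.
have x0 : 0 <= x by exact: fine_ge0.
have x1 : x <= 1 by rewrite -lee_fin pmuE// probability_le1.
have -> : h (ind mA) = eta x + eta (1 - x).
  apply: EFin_inj; rewrite hE /label_entropy (@esum_bounded _ 2); last 2 first.
  - move=> [|[|k]]// _; rewrite /prob (_ : _ @^-1` _ = set0) ?measure0.
      by rewrite /eta mul0r oppr0.
    by apply/seteqP; split => y; rewrite /= /ind_label; case: asboolP.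
  - by move=> k; rewrite eta_ge0// prob_le1//; exact: mlabel_ind.
  rewrite !big_nat_recr//= big_nil add0r /prob ind_label0 ind_label1 addrC.
  congr (eta _ + eta _)%:E; apply: EFin_inj.
  rewrite fineK ?fin_num_measure//; last exact: measurableC.
  by rewrite probability_setC// EFinB pmuE.
have := eta_le_sqrt x0; have := eta_1B_le x0 x1.
have : x <= Num.sqrt x.
  rewrite -{1}(sqr_sqrtr x0) expr2 ler_piMr ?sqrtr_ge0//.
  by rewrite -sqrtr1 ler_sqrt.
lra.
Qed.

(** Once [A] is known, [B] and its symmetric difference with [A] carry the same information. *)
Lemma hc_ind_le A B (mA : measurable A) (mB : measurable B) :
  hc (ind mB) (ind mA) <= 3 * Num.sqrt (pmu mu (B `+` A)).
Proof.
have mBA := measurable_setY mB mA.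
apply: le_trans (h_ind_le mBA); apply: le_trans (hc_le_h _ (ind mA)).
rewrite /hc lerD2r h_le// => x y /veeE[/ind_labelE eA /ind_labelE eBA].
apply/veeE; split; apply/ind_labelE => //.
move: eBA => /=; have [] := pselect (A x); have [] := pselect (A y);
have [] := pselect (B x); have [] := pselect (B y); tauto.
Qed.

Definition trunc n q : fpart mu :=
  @coarsen _ _ _ _ q (fun x => minn (q x) n) (fun x y (e : q x = q y) =>
    congr1 (minn^~ n) e).

Lemma refines_trunc n q : refines q (trunc n q).
Proof. by move=> x y /= ->. Qed.

(** Some finite partial sum of the entropy series is within [e] of its total. Truncation beyond the
    labels of that sum keeps their cells intact, so its entropy dominates the partial sum. *)
Lemma hc_trunc_small q (e : R) : 0 < e -> exists n, hc q (trunc n q) <= e.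
Proof.
move=> e0; have : ((h q - e)%:E < label_entropy mu q)%E.
  by rewrite -hE lte_fin ltrBlDr ltrDl.
rewrite /label_entropy => /ereal_sup_gt[_ [X [finX _] <-] Xlt].
have [n Xn] : exists n, forall k, X k -> (k < n)%N.
  have /finite_seqP[l ->] := finX.
  by exists (\max_(k <- l) k).+1 => k kl; rewrite ltnS; exact: leq_bigmax_seq.
exists n; rewrite /hc (@h_eq _ _ _ _ _ q); last 2 first.
- by move=> x y /veeE[].
- by move=> x y e'; apply/veeE; split => //; exact: refines_trunc.
suff : h q - e <= h (trunc n q) by lra.
rewrite -lee_fin hE; apply: (le_trans (ltW Xlt)).
apply: esum_ge; exists X => //.
apply: lee_fsum => // k Xk; rewrite lee_fin /prob.
rewrite (_ : trunc n q @^-1` _ = q @^-1` [set k])//.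
by apply/seteqP; split => x /=; have := Xn k Xk; lia.
Qed.

End Indicators.

Section Generators.
Context {R : realType} {d : measure_display} {T : measurableType d}.
Context {Gamma : groupType} {r : nat}.
Variables (mu : probability T R) (s : 'I_r -> Gamma) (a : Gamma -> T -> T).
Hypothesis ha : measure_preserving_action mu a.
Hypothesis hs : forall g, exists n, word_ball s n g.

Local Notation vee_ball := (vee_ball s ha).
Local Notation F := (F_label s ha).

Variable p : fpart mu.

(** Preimages of label sets are exactly the unions of cells. The radius may depend on the error,
    which is what makes the class closed under countable unions. *)
Definition approximable (A : set T) : Prop :=
  measurable A /\ forall e : R, 0 < e ->
    exists n (S : set nat), pmu mu (A `+` (vee_ball n p @^-1` S)) <= e.

Lemma ball_preimage_le m n (S : set nat) : (m <= n)%N ->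
  exists S', vee_ball m p @^-1` S = vee_ball n p @^-1` S'.
Proof.
move=> mn.
have [f fE] := refines_factor 0%N (@refines_ball_le _ _ _ _ _ _ s _ ha _ _ p mn).
by exists (f @^-1` S); rewrite fE.
Qed.

Lemma mball n (S : set nat) : measurable (vee_ball n p @^-1` S).
Proof. exact/mlabel_preimage/measurable_label. Qed.

Lemma approximable0 : approximable set0.
Proof.
split=> // e e0; exists 0%N, set0; rewrite preimage_set0 setY0 /pmu measure0.
exact: ltW.
Qed.

Lemma approximableC A : approximable A -> approximable (~` A).
Proof.
move=> [mA hA]; split; first exact: measurableC.
move=> e /hA[n [S AS]]; exists n, (~` S).
rewrite preimage_setC; rewrite (_ : _ `+` _ = A `+` (vee_ball n p @^-1` S))//.
by apply/seteqP; split => x /=; have [] := pselect (A x);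
  have [] := pselect (S (vee_ball n p x)); tauto.
Qed.

Lemma approximableU A B : approximable A -> approximable B ->
  approximable (A `|` B).
Proof.
move=> [mA hA] [mB hB]; split; first exact: measurableU.
move=> e e0; have e20 : 0 < e / 2 by rewrite divr_gt0.
have [n1 [S1 AS1]] := hA _ e20; have [n2 [S2 BS2]] := hB _ e20.
have [S1' E1] := ball_preimage_le S1 (leq_maxl n1 n2).
have [S2' E2] := ball_preimage_le S2 (leq_maxr n1 n2).
rewrite E1 in AS1; rewrite E2 in BS2.
exists (maxn n1 n2), (S1' `|` S2'); rewrite preimage_setU.
set D1 := _ @^-1` S1' in AS1 *; set D2 := _ @^-1` S2' in BS2 *.
have mD1 : measurable D1 by exact: mball.
have mD2 : measurable D2 by exact: mball.
apply: (@le_trans _ _ (pmu mu (A `+` D1) + pmu mu (B `+` D2))); last by lra.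
apply: pmu_leU.
- by apply: measurable_setY; exact: measurableU.
- exact: measurable_setY.
- exact: measurable_setY.
- by move=> x /=; tauto.
Qed.

Lemma approximable_bigcup (A : (set T)^nat) : (forall n, approximable (A n)) ->
  approximable (\bigcup_n A n).
Proof.
move=> hA; have mA n : measurable (A n) by have [] := hA n.
split; first exact: bigcupT_measurable.
move=> e e0; have e20 : 0 < e / 2 by rewrite divr_gt0.
have [n An] := bigcup_approx mu mA e20.
have [mAn] : approximable (\bigcup_(k < n) A k).
  rewrite bigcup_mkord; elim/big_ind : _ => //; first exact: approximable0.
  exact: approximableU.
move=> /(_ _ e20)[m [S AS]]; exists m, S.
have mU : measurable (\bigcup_n A n) by exact: bigcupT_measurable.
apply: le_trans (pmu_setY_trans mu mU mAn (mball m S)) _; lra.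
Qed.

Lemma refines_ball_shift k n g : word_ball s k g ->
  refines (vee_ball (k + n) p) (tshift ha g (vee_ball n p)).
Proof.
move=> [v vk vg] x y /vee_ballE H; apply/vee_ballE => _ [w wn <-].
rewrite -!(actM ha) -!invgM; apply: H; exists (v ++ w).
  by rewrite size_cat leq_add.
rewrite -vg /word_val; elim: v {vk vg} => [|l v IH] /=; first by rewrite mul1g.
by rewrite IH mulgA.
Qed.

(** Translation by a word of length at most [k] enlarges the radius by [k]; the measure of the
    symmetric difference is unchanged. *)
Lemma approximable_act g A : approximable A -> approximable (a g @` A).
Proof.
move=> [mA hA].
have mp := act_measure_preserving ha g^-1%g.
rewrite (act_image ha); split; first exact: (mp _ mA).1.
move=> e /hA[n [S AS]].
have [k gk] := hs g.
have [f fE] := refines_factor 0%N (refines_ball_shift (n := n) gk).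
exists (k + n)%N, (f @^-1` S).
rewrite (_ : vee_ball (k + n) p @^-1` _ = a g^-1%g @^-1` (vee_ball n p @^-1` S)); last first.
  have -> : a g^-1%g @^-1` (vee_ball n p @^-1` S) = tshift ha g (vee_ball n p) @^-1` S.
    by [].
  by rewrite fE.
rewrite (_ : _ `+` _ = a g^-1%g @^-1` (A `+` (vee_ball n p @^-1` S)))//.
by rewrite /pmu (mp _ _).2//; exact/measurable_setY/mball.
Qed.

Lemma approximable_invariant : invariant_sigma_algebra a approximable.
Proof.
split; last by move=> g A; exact: approximable_act.
split; first exact: approximable0.
- by move=> A hA; rewrite setTD; exact: approximableC.
- exact: approximable_bigcup.
Qed.

Lemma approximable_cell (S : set nat) : approximable (p @^-1` S).
Proof.
split; first exact/mlabel_preimage/measurable_label.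
have [f fE] := refines_factor 0%N (@refines_ball _ _ _ _ _ _ s _ ha 0%N p).
move=> e e0; exists 0%N, (f @^-1` S).
rewrite (_ : vee_ball 0 p @^-1` _ = p @^-1` S); last by rewrite fE.
by rewrite setYK /pmu measure0; exact: ltW.
Qed.

Variable P : set (set T).
Hypothesis cellP : forall A, P A -> exists S : set nat, A = p @^-1` S.
Hypothesis genP : forall B, measurable B ->
  exists2 A, smallest (invariant_sigma_algebra a) P A & mu (A `+` B) = 0%E.

Lemma measurable_approximable B : measurable B -> approximable B.
Proof.
move=> mB; have [A sA AB] := genP mB.
have [mA hA] : approximable A.
  apply: (sA approximable); split; first exact: approximable_invariant.
  by move=> C /cellP[S ->]; exact: approximable_cell.
split=> // e /hA[n [S AS]]; exists n, S.
apply: le_trans (pmu_setY_trans mu mB mA (mball n S)) _.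
by rewrite setYC {1}/pmu AB add0r.
Qed.

Lemma hc_ind_small B (mB : measurable B) (e : R) : 0 < e ->
  exists n, hc (ind mu mB) (vee_ball n p) <= e.
Proof.
move=> e0; have [_ hB] := measurable_approximable mB.
(* The error is chosen so that three times its square root is [e]. *)
have [n [S BS]] := hB ((e / 3) ^+ 2) ltac:(by rewrite exprn_gt0 ?divr_gt0).
exists n; have mD := mball n S.
apply: (@le_trans _ _ (hc (ind mu mB) (ind mu mD))).
  by apply: hc_refines => // x y xy; apply/ind_labelE; rewrite /= xy.
apply: le_trans (hc_ind_le _ _ _) _.
have : Num.sqrt (pmu mu (B `+` vee_ball n p @^-1` S)) <= e / 3.
  have -> : e / 3 = Num.sqrt ((e / 3) ^+ 2).
    by rewrite sqrtr_sqr ger0_norm// divr_ge0// ltW.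
  by rewrite ler_sqrt// exprn_ge0// divr_ge0// ltW.
lra.
Qed.

Lemma hc_ball_le m n q : (m <= n)%N ->
  hc q (vee_ball n p) <= hc q (vee_ball m p).
Proof. by move=> mn; apply: hc_refines => //; exact: refines_ball_le. Qed.

Lemma hc_ball_small q (e : R) : 0 < e ->
  exists n0, forall n, (n0 <= n)%N -> hc q (vee_ball n p) <= e.
Proof.
move=> e0; suff [n hn] : exists n, hc q (vee_ball n p) <= e.
  by exists n => m /hc_ball_le/le_trans; apply.
have [m hm] := hc_trunc_small q (divr_gt0 e0 (ltr0n R 2)).
suff [n hn] : exists n, hc (trunc m q) (vee_ball n p) <= e / 2.
  exists n; apply: le_trans (hc_chain q (trunc m q) (vee_ball n p)) _; lra.
have : 0 < e / 2 by rewrite divr_gt0.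
(* Raising the truncation level by one only separates the cell with label [m], hence costs one
   indicator; half of the error goes to it. Truncation at 0 is constant. *)
elim: m {hm} (e / 2) => [|m IH] e' e'0.
  exists 0%N; rewrite hc_eq0 ?ltW// => x y _ /=.
have [n1 h1] := IH _ (divr_gt0 e'0 (ltr0n R 2)).
have mm : measurable (q @^-1` [set m]) by exact: measurable_label.
have [n2 h2] := hc_ind_small mm (divr_gt0 e'0 (ltr0n R 2)).
exists (maxn n1 n2).
apply: (@le_trans _ _ (hc (vee (trunc m q) (ind mu mm)) (vee_ball (maxn n1 n2) p))).
  apply: hc_refines => // x y /veeE[/= e1 /ind_labelE /= e2].
  have := e1; have := e2; case: (ltngtP (q x) m); case: (ltngtP (q y) m); lia.
apply: le_trans (hc_vee_le _ _ _) _.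
have := hc_ball_le (trunc m q) (leq_maxl n1 n2).
have := hc_ball_le (ind mu mm) (leq_maxr n1 n2); lra.
Qed.

End Generators.

(** * The f-invariant does not depend on the generating partition *)

(* The empty cell is ignored because joins may or may not contain it. *)
Definition labels (T : Type) (P : set (set T)) (p : T -> nat) : Prop :=
  forall A, A !=set0 -> (P A <-> exists x, A = p @^-1` [set p x]).

Section Labelling.
Context {R : realType} {d : measure_display} {T : measurableType d}.
Implicit Types (mu : probability T R) (P Q : set (set T)) (p q : T -> nat).

Lemma entropy_labels mu P p : labels P p -> entropy mu P = label_entropy mu p.
Proof.
move=> Pp; rewrite /entropy /label_entropy.
pose e A : \bar R := (eta (fine (mu A)))%:E.
rewrite (_ : (\esum_(A in P) _)%E =
    (\esum_(A in (fun k => p @^-1` [set k]) @` range p) e A)%E); last first.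
  rewrite esum_mkcond [RHS]esum_mkcond; apply: eq_esum => A _.
  have [->|/set0P A0] := eqVneq A set0.
    by rewrite /e /eta measure0 mul0r oppr0; case: ifP; case: ifP.
  suff -> : (A \in P) =
      (A \in (fun k => p @^-1` [set k]) @` range p) by case: ifP.
  apply/idP/idP; rewrite !inE.
    by move=> /(Pp _ A0)[x ->]; exists (p x) => //; exists x.
  by move=> [_ [x _ <-] AE]; apply/(Pp _ A0); exists x.
rewrite esum_image; last first.
  move=> _ _ /set_mem[x _ <-] /set_mem[y _ <-] E.
  by have : (p @^-1` [set p x]) x by []; rewrite E.
rewrite esum_mkcond; apply: eq_esum => k _; case: ifPn => // /negP kp.
rewrite /prob (_ : _ @^-1` _ = set0) ?measure0 ?/eta ?mul0r ?oppr0//.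
by apply/seteqP; split => // x /= xk; apply: kp; rewrite inE; exists x.
Qed.

(** A point is labelled by the image of its cell under an injection of [P] into the natural
    numbers. *)
Lemma exists_labels P : measurable_partition P ->
  exists2 p, mlabel p & labels P p.
Proof.
move=> [cP mP tP UP].
have cell x : exists A, P A /\ A x.
  by have [A PA Ax] : (\bigcup_(A in P) A) x by [rewrite UP]; exists A.
have [c cE] := choice cell.
have [f finj] : exists f : set T -> nat, set_inj P f.
  by move/pcard_injP : cP => [f finj]; exists f.
have eqc x y : c y x -> c x = c y.
  move=> cyx; apply: tP; [exact: (cE _).1|exact: (cE _).1|].
  by exists x; split => //; exact: (cE x).2.
have fibre x : (f \o c) @^-1` [set f (c x)] = c x.
  apply/seteqP; split => y /=.
    move=> /finj; rewrite !inE => /(_ (cE _).1 (cE _).1) <-; exact: (cE _).2.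
  by move=> /eqc ->.
have lP : labels P (f \o c).
  move=> A [x Ax]; split => [PA|[y ->]].
    exists x; rewrite fibre; apply: tP => //; first exact: (cE _).1.
    by exists x; split => //; exact: (cE x).2.
  by rewrite fibre; exact: (cE _).1.
exists (f \o c) => // k; have [[x xk]|nx] := pselect (exists x, f (c x) = k).
  by rewrite -xk fibre; apply: mP; exact: (cE _).1.
rewrite (_ : _ @^-1` _ = set0)//.
by apply/seteqP; split => // x /= xk; apply: nx; exists x.
Qed.

Lemma labels_partition P p : mlabel p ->
  (forall A, P A <-> exists x, A = p @^-1` [set p x]) -> measurable_partition P.
Proof.
move=> mp PE; split.
- apply: (@sub_countable _ _ P ((fun k => p @^-1` [set k]) @` [set: nat])).
    by apply: subset_card_le => A /PE[x ->]; exists (p x).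
  exact: (sub_countable (card_image_le _ _)).
- by move=> A /PE[x ->].
- by move=> A B /PE[x ->] /PE[y ->] [z [/= <- <-]].
- by apply/seteqP; split => // x _; exists (p @^-1` [set p x]) => //;
    apply/PE; exists x.
Qed.

Lemma labels_cell P p A : labels P p -> P A -> exists S, A = p @^-1` S.
Proof.
move=> Pp PA; have [->|/set0P A0] := eqVneq A set0.
  by exists set0; rewrite preimage_set0.
by have [x ->] := (Pp _ A0).1 PA; exists [set p x].
Qed.

Lemma labels_join mu P Q (p q : fpart mu) : labels P p -> labels Q q ->
  labels (join P Q) (vee p q).
Proof.
have fibre x : vee p q @^-1` [set vee p q x] =
    p @^-1` [set p x] `&` q @^-1` [set q x].
  by apply/seteqP; split => y; move/veeE.
move=> Pp Qq A A0; split => [[B PB [C QC BC]]|[x ->]].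
  case: A0 => x Ax; have [Bx Cx] : (B `&` C) x by rewrite BC.
  have [y BE] := (Pp _ (ex_intro _ x Bx)).1 PB.
  have [z CE] := (Qq _ (ex_intro _ x Cx)).1 QC.
  exists x; rewrite fibre -BC BE CE; move: Bx Cx; rewrite BE CE /=.
  by move=> -> ->.
exists (p @^-1` [set p x]); first by apply/Pp; [exists x|exists x].
exists (q @^-1` [set q x]); first by apply/Qq; [exists x|exists x].
by rewrite fibre.
Qed.

End Labelling.

Section FInvariantLabels.
Context {R : realType} {d : measure_display} {T : measurableType d}.
Context {Gamma : groupType} {r : nat}.
Variables (mu : probability T R) (s : 'I_r -> Gamma) (a : Gamma -> T -> T).
Hypothesis ha : measure_preserving_action mu a.
Hypothesis hs : forall g, exists n, word_ball s n g.
Implicit Types (P Q : set (set T)) (p q : fpart mu).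

Local Notation vee_ball := (vee_ball s ha).
Local Notation F := (F_label s ha).

Lemma labels_translate P p g : labels P p ->
  labels (translate a g P) (tshift ha g p).
Proof.
move=> Pp A A0; split => [[B PB BA]|[x ->]].
  have B0 : B !=set0 by case: A0; rewrite -BA => _ [x Bx _]; exists x.
  have [x BE] := (Pp _ B0).1 PB.
  exists (a g x); rewrite -BA (act_image ha) BE.
  by apply/seteqP; split => y /=; rewrite (actK ha).
exists (p @^-1` [set p (a g^-1%g x)]); last by rewrite (act_image ha).
by apply/Pp; eexists => //=.
Qed.

Lemma labels_join_over P p n : labels P p ->
  labels (join_over a (word_ball s n) P) (vee_ball n p).
Proof.
move=> Pp A A0; split => [[B PB AE]|[x ->]].
  case: A0 => x Ax; exists x.
  have Bx w : word_ball s n w -> B w (a w^-1%g x).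
    by move=> wn; move: Ax; rewrite AE => /(_ w wn); rewrite (act_image ha).
  have BE w : word_ball s n w -> B w = p @^-1` [set p (a w^-1%g x)].
    move=> wn; have [y BE] := (Pp _ (ex_intro _ _ (Bx w wn))).1 (PB w wn).
    by have := Bx w wn; rewrite BE /= => ->.
  rewrite AE; apply/seteqP; split => y.
    move=> By; apply/vee_ballE => w wn.
    by have := By w wn; rewrite (act_image ha) BE.
  by move=> /vee_ballE xy w wn; rewrite (act_image ha) BE//=; exact: xy.
exists (fun w => p @^-1` [set p (a w^-1%g x)]).
  by move=> w wn; apply/Pp; eexists => //=.
apply/seteqP; split => y.
  by move=> /vee_ballE xy w wn; rewrite (act_image ha) /=; exact: xy.
by move=> xy; apply/vee_ballE => w wn; have := xy w wn; rewrite (act_image ha).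
Qed.

Lemma F_partition_labels P p : labels P p ->
  F_partition s mu a P = (F p)%:E.
Proof.
move=> Pp; rewrite /F_partition (entropy_labels mu Pp) -hE.
rewrite /F_label [RHS]EFinD [in RHS]EFinM -sumEFin; congr (_ + _)%E.
apply: eq_bigr => i _.
by rewrite (entropy_labels mu (labels_join Pp (labels_translate (s i) Pp))) -hE.
Qed.

Definition f_label p : \bar R :=
  ereal_inf [set (F (vee_ball n p))%:E | n in [set n | (0 < n)%N]].

Lemma f_partition_labels P p : labels P p -> f_partition s mu a P = f_label p.
Proof.
move=> Pp; rewrite /f_partition /f_label; congr ereal_inf.
by apply: eq_imagel => n _; apply: F_partition_labels; exact: labels_join_over.
Qed.

(** The comparison of two partitions uses generation only in this form, with [q] ranging over all
    partitions of finite entropy. *)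
Definition asymptotically_generating p := forall q (e : R), 0 < e ->
  exists n0, forall n, (n0 <= n)%N -> hc q (vee_ball n p) <= e.

(* [F (p^k v q) <= F (p^k) + H(q | p^k)], further splitting by [q] does not
   increase [F], and [p^k] can be dropped from [p^k v q^m] at a cost
   controlled by [H(p^k | q^m)]. *)
Lemma F_vee_ball_generating_le p q n (e : R) :
  asymptotically_generating p -> asymptotically_generating q -> 0 < e ->
  exists2 m, (0 < m)%N & F (vee_ball m q) <= F (vee_ball n p) + e.
Proof.
(* Joining [q] costs one [e'] and dropping the ball of [p] costs 2r of them. *)
move=> gp gq e0; pose e' := e / (2 * r%:R + 1).
have re0 : 0 < 2 * r%:R + 1 :> R by rewrite ltr_wpDl// mulr_ge0.
have e'0 : 0 < e' by rewrite divr_gt0.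
have [k1 hk1] := gp q e' e'0; pose k := maxn n k1.
have {}hk1 := hk1 k (leq_maxr _ _).
have Fk : F (vee_ball k p) <= F (vee_ball n p) by apply: F_ball_le; exact: leq_maxl.
have Fkq := F_vee_le s ha (vee_ball k p) q.
(* The radius is kept positive because the infimum runs over positive radii. *)
have [m1 hm1] := gq (vee_ball k p) e' e'0; pose m := maxn 1 m1.
have {}hm1 := hm1 m (leq_maxr _ _).
exists m; first exact: leq_maxl.
have Fm := F_le_vee s ha (vee_ball m q) (vee_ball k p).
have Fkqm : F (vee (vee (vee_ball k p) q) (vee_ball m q)) <=
    F (vee (vee_ball k p) q).
  by apply: F_vee_ball_le => x y /veeE[].
have Feq : F (vee (vee (vee_ball k p) q) (vee_ball m q)) =
    F (vee (vee_ball m q) (vee_ball k p)).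
  apply: F_eq => x y /veeE[].
    by move=> /veeE[? _] ?; apply/veeE.
  move=> e1 e2; apply/veeE; split => //; apply/veeE; split => //.
  exact: refines_ball e1.
have : e = 2 * r%:R * e' + e'.
  have -> : 2 * r%:R * e' + e' = (2 * r%:R + 1) * e' by ring.
  by rewrite /e' mulrCA divff ?gt_eqF// mulr1.
have : 2 * r%:R * hc (vee_ball k p) (vee_ball m q) <= 2 * r%:R * e'.
  by rewrite ler_wpM2l// mulr_ge0.
lra.
Qed.

Lemma f_label_le p q : asymptotically_generating p ->
  asymptotically_generating q -> (f_label q <= f_label p)%E.
Proof.
move=> gp gq; apply: le_ereal_inf_tmp => _ [n _ <-].
apply/lee_addgt0Pr => e e0.
have [m m0 Fm] := F_vee_ball_generating_le n gp gq e0.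
by apply: (@le_trans _ _ (F (vee_ball m q))%:E);
  [apply: ereal_inf_lbound; exists m|rewrite -EFinD lee_fin].
Qed.

Lemma generating_labels P : finite_entropy_generating mu a P ->
  exists p, labels P p /\ asymptotically_generating p.
Proof.
move=> [[mP gP] fP]; have [p mp Pp] := exists_labels mP.
rewrite (entropy_labels mu Pp) in fP.
exists (FPart mp fP); split => // q e e0.
by apply: (hc_ball_small ha hs _ gP) => // A; exact: labels_cell.
Qed.

Lemma f_invariant_labels P p : finite_entropy_generating mu a P ->
  labels P p -> asymptotically_generating p ->
  f_invariant s mu a = f_label p.
Proof.
move=> gP Pp gp; rewrite /f_invariant; set V := [set v | _].
(* The set of common values contains [f_label p], so [get] returns a member of it, and any member
   can be evaluated at [P]. *)
have [_ /(_ P gP) <-] : V (get V); last by rewrite (f_partition_labels Pp).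
apply: getPex; exists (f_label p); split; first by exists P.
move=> Q /generating_labels[q [Qq gq]]; rewrite (f_partition_labels Qq).
by apply/eqP; rewrite eq_le !f_label_le.
Qed.

End FInvariantLabels.

(** * Haar measure *)

Section BorelTopology.
Variable R : realType.

Lemma metrizable_second_countable (T : ptopologicalType) :
  compact [set: T] -> metrizable R T -> @second_countable T.
Proof.
move=> cT [M [f [g [fgK gfK cf cg]]]].
pose M' : pseudoPMetricType R :=
  HB.pack (Metric.sort M) (isPointed.Build (Metric.sort M) (f point)) M.
have cM : compact [set: M'].
  have -> : [set: M'] = f @` [set: T].
    by apply/seteqP; split => // x _; exists (g x) => //; exact: gfK.
  by apply: continuous_compact => //; exact: continuous_subspaceT.
have [B cB [oB bB]] := compact_second_countable cM.
exists [set f @^-1` U | U in B].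
  exact: (sub_countable (card_image_le _ _)).
split; first by move=> _ [U BU <-]; apply: open_comp => [x _|]; [exact: cf|exact: oB].
move=> x A Ax.
have : nbhs (f x) (g @^-1` A).
  by have := cg (f x); rewrite /continuous_at fgK; apply.
move=> /bB[U [BU Ufx] UA]; exists (f @^-1` U).
  by split => //; exists U.
by move=> y /= /UA /=; rewrite fgK.
Qed.

Lemma enum_basis (T : topologicalType) : @second_countable T ->
  exists2 b : nat -> set T, (forall n, open (b n)) &
    forall (x : T) A, nbhs x A -> exists n, b n x /\ b n `<=` A.
Proof.
move=> [B cB [oB bB]].
have [/eqP B0|B0] := boolP (B == set0).
  exists (fun=> set0); first by move=> _; exact: open0.
  by move=> x A /bB[U []]; rewrite B0.
have /pfcard_geP[/eqP|[f]] := cB.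
  by rewrite (negbTE B0).
exists f; first by move=> n; apply: oB; exact: funS.
move=> x A /bB[U [BU Ux] UA].
by have [n _ fn] := @surj _ _ _ _ f U BU; exists n; rewrite fn.
Qed.

End BorelTopology.

Section Haar.
Variables (R : realType) (G : topologicalGroupType).
Hypothesis Gcompact : compact [set: G].
Hypothesis Gmetrizable : metrizable R G.

Lemma measurable_borel_continuous (f : G -> G) : continuous f ->
  measurable_fun [set: borel G] (f : borel G -> borel G).
Proof.
move=> cf; apply: (@measurability _ _ (borel G) (borel G) setT f (@open G)) => //.
move=> _ [A oA <-]; rewrite setTI; apply: sub_sigma_algebra.
by apply: open_comp => // x _; exact: cf.
Qed.

(** Continuity gives an open preimage in the product topology, while measurability refers to the
    product sigma-algebra. A countable base reconciles them: the preimage is a countable union of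
    basic rectangles. *)
Lemma measurable_borel_mul :
  measurable_fun [set: borel G * borel G]
    (fun z : borel G * borel G => ((z.1 : G) * (z.2 : G))%g : borel G).
Proof.
apply: (@measurability _ _ (borel G * borel G)%type (borel G) setT _ (@open G)) => //.
move=> _ [A oA <-]; rewrite setTI.
have [b ob bP] := enum_basis (metrizable_second_countable Gcompact Gmetrizable).
pose W n m : set (borel G * borel G) :=
  if `[< b n `*` b m `<=` (fun z : G * G => (z.1 * z.2)%g) @^-1` A >]
  then b n `*` b m else set0.
rewrite (_ : _ @^-1` A = \bigcup_n \bigcup_m W n m).
  apply: bigcupT_measurable => n; apply: bigcupT_measurable => m.
  rewrite /W; case: ifP => // _.
  by apply: measurableX; apply: sub_sigma_algebra; exact: ob.
apply/seteqP; split => [[x y] /= Axy|z [n _ [m _]]]; last first.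
  by rewrite /W; case: asboolP => // + /=; apply.
have : nbhs (x, y) ((fun z : G * G => (z.1 * z.2)%g) @^-1` A).
  apply: (@mulg_continuous G (x, y)); exact: open_nbhs_nbhs.
move=> [[B C] [/= Bx Cy] BC].
have [n [bnx bnB]] := bP _ _ Bx.
have [m [bmy bmC]] := bP _ _ Cy.
exists n => //; exists m => //; rewrite /W; case: asboolP => //= -[].
by move=> [u v] [/= /bnB Bu /bmC Cv]; exact: (BC (u, v)).
Qed.

Lemma measurable_borel_inv :
  measurable_fun [set: borel G] (fun x : borel G => ((x : G)^-1)%g : borel G).
Proof. by apply: measurable_borel_continuous => x; exact: invg_continuous. Qed.

Lemma measurable_borel_preimage (f : G -> G) (A : set (borel G)) :
  continuous f -> measurable A -> measurable ((f @^-1` A) : set (borel G)).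
Proof.
move=> /measurable_borel_continuous mf mA; rewrite -[_ @^-1` _]setTI; exact: mf.
Qed.

Lemma continuous_mulr (g : G) : continuous (fun x : G => (x * g)%g).
Proof.
move=> x; apply: (@continuous_comp _ _ _ (fun x : G => (x, g))
  (fun z : G * G => (z.1 * z.2)%g)); last exact: mulg_continuous.
by apply: cvg_pair => //; exact: cvg_cst.
Qed.

(** The set of pairs whose product lies in [A] has product measure [m2 A] when the second variable
    is integrated first, by left invariance, and [m1 A] in the other order. *)
Lemma left_right_invariant_eq (m1 m2 : probability (borel G) R) :
  (forall (g : G) (A : set (borel G)), measurable A ->
    m1 ((fun x : G => (x * g)%g) @^-1` A) = m1 A) ->
  (forall (g : G) (A : set (borel G)), measurable A ->
    m2 ((fun x : G => (g * x)%g) @^-1` A) = m2 A) ->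
  forall A : set (borel G), measurable A -> m1 A = m2 A.
Proof.
move=> r1 l2 A mA.
pose M : set (borel G * borel G) := (fun z => ((z.1 : G) * (z.2 : G))%g) @^-1` A.
have mM : measurable M by rewrite -[M]setTI; exact: measurable_borel_mul.
have E12 : (m1 \x m2)%E M = (m1 \x^ m2)%E M.
  apply: (@product_measure_unique _ _ _ _ _ m1 m2 (m1 \x^ m2)%E) => //.
  by move=> B C mB mC; exact: product_measure2E.
have <- : (m1 \x m2)%E M = m2 A.
  rewrite /product_measure1 (eq_integral (fun=> m2 A)).
    by rewrite integral_cst// -[RHS]mule1; congr (_ * _)%E; exact: probability_setT.
  move=> x _ /=; rewrite -[RHS](l2 x A mA); congr (m2 _).
  by apply/seteqP; split => y; rewrite /xsection /= inE.
apply/esym; rewrite E12 /product_measure2 (eq_integral (fun=> m1 A)).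
  by rewrite integral_cst// -[RHS]mule1; congr (_ * _)%E; exact: probability_setT.
move=> x _ /=; rewrite -[RHS](r1 x A mA); congr (m1 _).
by apply/seteqP; split => y; rewrite /ysection /= inE.
Qed.

Variable mu : probability (borel G) R.
Hypothesis hmu : is_haar mu.

Lemma haar_mull (g : G) (A : set (borel G)) : measurable A ->
  mu ((fun x : G => (g * x)%g) @^-1` A) = mu A.
Proof.
move=> mA; rewrite -(hmu g^-1%g mA); congr (mu _).
apply/seteqP; split => [x gx|_ [x Ax <-]] /=.
  by exists (g * x)%g => //; rewrite mulKg.
by rewrite mulVKg.
Qed.

Definition image_probability (f : G -> G)
    (mf : measurable_fun [set: borel G] (f : borel G -> borel G)) :
    probability (borel G) R :=
  distribution mu (mfun_Sub (mem_set mf)).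

(** The image of a left-invariant measure under inversion is right-invariant, hence equal to
    [mu]. *)
Lemma haar_inv (A : set (borel G)) : measurable A ->
  mu ((fun x : G => x^-1%g) @^-1` A) = mu A.
Proof.
move=> mA.
apply: (@left_right_invariant_eq (image_probability measurable_borel_inv) mu _ _ A) => //.
  move=> g B mB; rewrite /image_probability /distribution /pushforward /=.
  rewrite -[RHS](haar_mull g^-1%g); last first.
    exact: (@measurable_borel_preimage _ _ (@invg_continuous G)).
  congr (mu _); apply/seteqP; split => x /=; rewrite invgM invgK//.
exact: haar_mull.
Qed.

Lemma haar_mulr (g : G) (A : set (borel G)) : measurable A ->
  mu ((fun x : G => (x * g)%g) @^-1` A) = mu A.
Proof.
move=> mA; rewrite -[RHS]haar_inv//.
have mB : measurable ((fun x : G => x^-1%g) @^-1` A : set (borel G)).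
  exact: (@measurable_borel_preimage _ _ (@invg_continuous G)).
rewrite -(haar_mull g^-1%g mB) -[LHS]haar_inv; last first.
  exact: (@measurable_borel_preimage _ _ (@continuous_mulr g)).
by congr (mu _); apply/seteqP; split => x /=; rewrite invgM invgK.
Qed.

(** The image of [mu] under [f] is left-invariant: by surjectivity every translation by [g] lifts to
    the translation by [f' g]. *)
Lemma haar_automorphism (f : G -> G) (A : set (borel G)) :
  {morph f : x y / (x * y)%g} ->
  continuous f -> (exists f' : G -> G, cancel f' f) ->
  measurable A -> mu (f @^-1` A) = mu A.
Proof.
move=> fM cf [f' f'K] mA.
have mf := measurable_borel_continuous cf.
apply/esym/(@left_right_invariant_eq mu (image_probability mf) _ _ A) => //.
  exact: haar_mulr.
move=> g B mB; rewrite /image_probability /distribution /pushforward /=.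
rewrite -[RHS](haar_mull (f' g)); last exact: measurable_borel_preimage.
by congr (mu _); apply/seteqP; split => x /=; rewrite fM f'K.
Qed.

End Haar.

(** * Products and completions *)

Section SmallestInvariant.
Context {R : realType} {d : measure_display} {T : measurableType d}.
Context {Gamma : groupType}.
Variables (mu : probability T R) (a : Gamma -> T -> T).
Hypothesis ha : measure_preserving_action mu a.
Implicit Types (P S : set (set T)) (A B : set T).

Lemma invariant_smallest P :
  invariant_sigma_algebra a (smallest (invariant_sigma_algebra a) P).
Proof.
split; first split.
- by move=> S [[[]]].
- by move=> A hA S hS; have [[[_ SC _] _] _] := hS; apply: SC; exact: hA.
- by move=> A hA S hS; have [[[_ _ SU] _] _] := hS; apply: SU => n; exact: hA.
- by move=> g A hA S hS; have [[_ Sa] _] := hS; apply: Sa; exact: hA.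
Qed.

Lemma invariant_measurable : invariant_sigma_algebra a (@measurable _ T).
Proof.
split; first split; first exact: measurable0.
- by move=> A mA; rewrite setTD; exact: measurableC.
- by move=> A mA; exact: bigcupT_measurable.
- move=> g A mA; rewrite (act_image ha).
  exact: (act_measure_preserving ha g^-1%g mA).1.
Qed.

Lemma smallest_measurable P : P `<=` measurable ->
  smallest (invariant_sigma_algebra a) P `<=` measurable.
Proof. by move=> mP; apply: smallest_sub => //; exact: invariant_measurable. Qed.

(** Generation is only known modulo null sets, so the class shown to contain all product-measurable
    sets must absorb null changes while staying an invariant sigma-algebra. *)
Definition ae_in S B := measurable B /\
  exists A, [/\ S A, measurable A & mu (A `+` B) = 0%E].

Lemma ae_in_sub S A : S A -> measurable A -> ae_in S A.
Proof. by move=> SA mA; split => //; exists A; rewrite setYK measure0. Qed.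

Lemma null_sub A B : measurable A -> measurable B -> A `<=` B ->
  mu B = 0%E -> mu A = 0%E.
Proof.
move=> mA mB AB B0; apply/eqP; rewrite eq_le measure_ge0 andbT -B0.
by rewrite le_measure ?inE.
Qed.

Lemma ae_in_null S A B : ae_in S A -> measurable B -> mu (A `+` B) = 0%E ->
  ae_in S B.
Proof.
move=> [mA [C [SC mC CA]]] mB AB; split => //; exists C; split => //.
apply: (@null_sub _ ((C `+` A) `|` (A `+` B))).
- exact: measurable_setY.
- by apply: measurableU; exact: measurable_setY.
- by move=> x /=; have [] := pselect (A x); tauto.
- by rewrite measureU0//; exact: measurable_setY.
Qed.

Lemma invariant_ae_in S : invariant_sigma_algebra a S ->
  invariant_sigma_algebra a (ae_in S).
Proof.
move=> [[S0 SC SU] Sa]; split; first split.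
- exact: ae_in_sub.
- move=> B [mB [A [SA mA AB]]]; rewrite setTD; split; first exact: measurableC.
  exists (~` A); split; [by rewrite -setTD; exact: SC|exact: measurableC|].
  rewrite (_ : _ `+` _ = A `+` B)//.
  by apply/seteqP; split => x /=; have [] := pselect (A x);
    have [] := pselect (B x); tauto.
- move=> B hB; have mB n : measurable (B n) by have [] := hB n.
  have [A hA] := choice (fun n => (hB n).2).
  split; first exact: bigcupT_measurable.
  have mA n : measurable (A n) by have [] := hA n.
  exists (\bigcup_n A n); split; first by apply: SU => n; have [] := hA n.
    exact: bigcupT_measurable.
  apply: (@null_sub _ (\bigcup_n (A n `+` B n))).
  + by apply: measurable_setY; exact: bigcupT_measurable.
  + by apply: bigcupT_measurable => n; exact: measurable_setY.
  + move=> x [[[n _ Ax] nB]|[[n _ Bx] nA]]; exists n => //.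
      by left; split => // Bx; apply: nB; exists n.
    by right; split => // Ax; apply: nA; exists n.
  + apply/eqP; rewrite eq_le measure_ge0 andbT.
    have mAB n : measurable (A n `+` B n) by exact: measurable_setY.
    apply: (le_trans (measure_sigma_subadditive mu mAB _ (@subset_refl _ _))).
      exact: bigcupT_measurable.
    by rewrite eseries0// => n _ _; have [] := hA n.
- move=> g B [mB [A [SA mA AB]]]; have mp := act_measure_preserving ha g^-1%g.
  rewrite (act_image ha); split; first exact: (mp _ mB).1.
  exists (a g @` A); split; first exact: Sa.
    by rewrite (act_image ha); exact: (mp _ mA).1.
  rewrite (act_image ha) (_ : _ `+` _ = a g^-1%g @^-1` (A `+` B))//.
  by rewrite (mp _ _).2//; exact: measurable_setY.
Qed.

Lemma invariant_preimage S : invariant_sigma_algebra a S ->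
  forall g A, S A -> S (a g @^-1` A).
Proof.
move=> [_ Sa] g A SA; have := Sa g^-1%g A SA.
by rewrite (act_image ha) invgK.
Qed.

End SmallestInvariant.

Section ProductEntropy.
Context {R : realType} {d1 d2 : measure_display}.
Context {X : measurableType d1} {Y : measurableType d2}.
Variables (nu : probability X R) (mu : probability Y R).

Let num : probability (X * Y)%type R := (nu \x mu)%E.

Lemma fst_measure_preserving : measure_preserving num nu fst.
Proof.
move=> A mA.
have -> : fst @^-1` A = A `*` [set: Y] by apply/seteqP; split => z //= [].
split; first exact: measurableX.
rewrite /num /= product_measure1E// -[RHS]mule1; congr (_ * _)%E.
exact: probability_setT.
Qed.

Lemma snd_measure_preserving : measure_preserving num mu snd.
Proof.
move=> A mA.
have -> : snd @^-1` A = [set: X] `*` A by apply/seteqP; split => z //= [].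
split; first exact: measurableX.
rewrite /num /= product_measure1E// -[RHS]mul1e; congr (_ * _)%E.
exact: probability_setT.
Qed.

(** Cells of the join have product mass. With both entropies written as sums over the cells of the
    join, additivity of the logarithm is used term by term, null cells contributing zero. *)
Lemma h_product (p : fpart nu) (q : fpart mu) :
  h (vee (pull fst_measure_preserving p) (pull snd_measure_preserving q)) =
  h p + h q.
Proof.
set u := pull _ p; set v := pull _ q; set z := vee u v.
have <- : h u = h p by exact: h_pull.
have <- : h v = h q by exact: h_pull.
suff key : (label_entropy num z = label_entropy num u + label_entropy num v)%E.
  by move: key; rewrite -(hE z) -(hE u) -(hE v) => -[].
have [f fE] : exists f, label u = f \o z.
  by apply: (refines_factor 0%N) => x y /veeE[].
have [g gE] : exists g, label v = g \o z.
  by apply: (refines_factor 0%N) => x y /veeE[].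
have mz := measurable_label z.
have uE := label_entropy_factor num f mz; rewrite -fE in uE.
have vE := label_entropy_factor num g mz; rewrite -gE in vE.
have t0 w k j : mlabel w -> 0 <= prob num z k * - ln (prob num w j).
  by move=> mw; rewrite mulr_ge0 ?prob_ge0// oppr_ge0 ln_le0// prob_le1.
rewrite uE vE -esumD; last 2 first.
- by move=> k _; rewrite lee_fin t0//; exact: measurable_label.
- by move=> k _; rewrite lee_fin t0//; exact: measurable_label.
apply: eq_esum => k _; rewrite -EFinD /eta -mulrN -mulrDr.
have [->|zk0] := eqVneq (prob num z k) 0; first by rewrite !mul0r.
congr (_ * _)%:E.
have [[x zx]|nx] := pselect (exists x, z x = k); last first.
  exfalso; move/eqP: zk0; apply; rewrite /prob (_ : _ @^-1` _ = set0) ?measure0//.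
  by apply/seteqP; split => // x /= zx; apply: nx; exists x.
have fk : f k = p x.1 by rewrite -zx -[f (z x)]/((f \o z) x) -fE.
have gk : g k = q x.2 by rewrite -zx -[g (z x)]/((g \o z) x) -gE.
have pE : prob num z k = prob num u (f k) * prob num v (g k).
  apply: EFin_inj; rewrite EFinM !probE//; try exact: measurable_label.
  rewrite fk gk.
  rewrite (fst_measure_preserving (measurable_label p _)).2.
  rewrite (snd_measure_preserving (measurable_label q _)).2.
  rewrite -product_measure1E; try exact: measurable_label.
  congr (num _); apply/seteqP; split => y /=.
    by rewrite -zx => /pair_labelE[].
  by rewrite -zx => -[? ?]; apply/pair_labelE.
rewrite pE lnM ?opprD// posrE lt0r prob_ge0 andbT.
  by apply: contra_neq zk0; rewrite pE => ->; rewrite mul0r.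
by apply: contra_neq zk0; rewrite pE => ->; rewrite mulr0.
Qed.

End ProductEntropy.

(** * The skew product *)

Section SkewProduct.
Context {R : realType} {Gamma : groupType} {d : measure_display}.
Context {X : measurableType d} {G : topologicalGroupType}.
Variables (nu : probability X R) (alpha : Gamma -> X -> X).
Hypothesis halpha : measure_preserving_action nu alpha.
Hypothesis Gcompact : compact [set: G].
Hypothesis Gmetrizable : metrizable R G.
Variable beta : Gamma -> G -> G.
Hypothesis hbeta : automorphism_action beta.
Variable sigma : Gamma -> X -> G.
Hypothesis hsigma : cocycle alpha beta sigma.
Variable mu : probability (borel G) R.
Hypothesis hmu : is_haar mu.

Let num : probability (X * borel G)%type R := (nu \x mu)%E.
Let skew : Gamma -> (X * borel G)%type -> (X * borel G)%type :=
  skew_product alpha beta sigma.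

Lemma beta_measure_preserving_action :
  @measure_preserving_action R Gamma _ (borel G) mu beta.
Proof.
case: hbeta => [[b1 bM] bmul cb]; split => //.
  by move=> g; exact: measurable_borel_continuous.
move=> g A mA; apply: haar_automorphism => //.
by exists (beta g^-1%g) => x; rewrite -bM mulgV b1.
Qed.

Lemma cocycle1 x : sigma 1%g x = 1%g.
Proof.
case: hsigma => _ /(_ 1%g 1%g x); rewrite mulg1.
case: hbeta => [[b1 _] _ _]; case: halpha => -[a1 _] _ _.
by rewrite b1 a1 => /(congr1 (fun y => (sigma 1%g x)^-1 * y)%g); rewrite mulVg mulKg.
Qed.

Lemma measurable_skew g : measurable_fun [set: X * borel G] (skew g).
Proof.
case: halpha => _ ma _; case: hsigma => ms _; case: hbeta => _ _ cb.
apply/measurable_fun_pairP; split.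
  by apply: (measurableT_comp (ma g)); exact: measurable_fst.
have mb := measurable_borel_continuous (cb g).
have mp : measurable_fun [set: X * borel G]
    (fun z : X * borel G => ((beta g z.2 : borel G), (sigma g z.1 : borel G))).
  apply/measurable_fun_pairP; split.
    by apply: (measurableT_comp mb); exact: measurable_snd.
  by apply: (measurableT_comp (ms g)); exact: measurable_fst.
exact: (measurableT_comp (measurable_borel_mul Gcompact Gmetrizable) mp).
Qed.

(** The fibre map over [x] is an automorphism followed by right translation by [sigma g x], so it
    preserves Haar measure; a change of variable by [alpha g] handles the base. *)
Lemma skew_measure_preserving_action : measure_preserving_action num skew.
Proof.
have [[a1 aM] ma pa] := halpha.
have [[b1 bM] bmul cb] := hbeta.
have [ms sM] := hsigma.
split; last 1 first.
- move=> g A mA.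
  have mT : measurable (skew g @^-1` A).
    by rewrite -[_ @^-1` _]setTI; exact: measurable_skew.
  rewrite /num /= /product_measure1.
  rewrite (eq_integral ((mu \o xsection A) \o alpha g)); last first.
    move=> x _ /=.
    have mS : measurable (xsection A (alpha g x)) by exact: measurable_xsection.
    rewrite -[RHS](haar_mulr Gcompact Gmetrizable hmu (sigma g x) mS).
    rewrite -[RHS](haar_automorphism Gcompact Gmetrizable hmu (bmul g) (cb g)).
    + by congr (mu _); apply/seteqP; split => y; rewrite /xsection /= !inE.
    + by exists (beta g^-1%g) => y; rewrite -bM mulgV b1.
    + exact: (measurable_borel_preimage (@continuous_mulr _ _)).
  rewrite -[LHS](@ge0_integral_pushforward _ _ _ _ R (alpha g) (ma g) nu setT
    (mu \o xsection A))//; last first.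
    exact: measurable_fun_xsection.
  by apply: eq_measure_integral => B mB _; exact: pa.
- split; first by move=> [x y]; rewrite /skew /skew_product /= cocycle1 a1 b1 mulg1.
  move=> g g' [x y]; rewrite /skew /skew_product /= aM sM; congr pair.
  by rewrite bM bmul mulgA.
- exact: measurable_skew.
Qed.

End SkewProduct.

(** * Coset labels of a normal subgroup *)

Section NormalCosets.
Variables (G : groupType) (N : set G).
Hypothesis hN : normal_subgroup N.

Lemma subgroupV x : N x -> N x^-1%g.
Proof.
by case: hN => -[N1 Nd] _ Nx; have := Nd _ _ N1 Nx; rewrite mul1g.
Qed.

Lemma subgroupM x y : N x -> N y -> N (x * y)%g.
Proof.
case: hN => -[N1 Nd] _ Nx /subgroupV Ny; have := Nd _ _ Nx Ny.
by rewrite invgK.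
Qed.

Lemma left_cosetE g x : [set (g * y)%g | y in N] x <-> N (g^-1 * x)%g.
Proof.
split=> [[y Ny <-]|Nx]; first by rewrite mulKg.
by exists (g^-1 * x)%g => //; rewrite mulVKg.
Qed.

Variable c : G -> nat.
Hypothesis cN : forall x y, c x = c y <-> N (x^-1 * y)%g.

(** By normality [c] labels the quotient group, in which right factors with the same class can be
    cancelled. *)
Lemma coset_label_mul x y z t : c x = c y ->
  (c (z * x)%g = c (t * y)%g <-> c z = c t).
Proof.
move=> /cN xy; rewrite !cN; case: hN => _ NJ.
(* The quotient is a conjugate of [z^-1 * t] times an element of [N]. *)
have -> : ((z * x)^-1 * (t * y) = x^-1 * (z^-1 * t) * x * (x^-1 * y))%g.
  by rewrite invgM !mulgA mulgK.
split=> [zt|zt]; last first.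
  apply: subgroupM => //.
  by have := NJ x^-1%g _ zt; rewrite invgK.
have := subgroupM zt (subgroupV xy); rewrite mulgK => /(NJ x).
by rewrite !mulgA mulgV mul1g mulgK.
Qed.

End NormalCosets.

(** All errors lie between 0 and [e]; one carries weight 1 - 2r and [r] of them weight 1, whence the
    bound (2r + 1)e. *)
Lemma sum_error (R : realFieldType) r (A a b e : R) (Ai Bi Ci : 'I_r -> R) :
  a + b <= A -> A <= a + b + e ->
  (forall i, Bi i + Ci i <= Ai i) -> (forall i, Ai i <= Bi i + Ci i + e) ->
  0 <= e ->
  `|((1 - 2 * r%:R) * A + \sum_(i < r) Ai i) -
    (((1 - 2 * r%:R) * a + \sum_(i < r) Bi i) +
     ((1 - 2 * r%:R) * b + \sum_(i < r) Ci i))| <= 2 * r%:R * e + e.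
Proof.
move=> L U Li Ui e0.
have := @ler_sum _ _ (index_enum _) xpredT _ _ (fun i _ => Ui i).
have := @ler_sum _ _ (index_enum _) xpredT _ _ (fun i _ => Li i).
rewrite !big_split /= sumr_const card_ord -mulr_natl.
set S := \sum_(i < r) Ai i; set S1 := \sum_(i < r) Bi i.
set S2 := \sum_(i < r) Ci i => H1 H2.
have r0 : 0 <= r%:R :> R by [].
have : r%:R * (A - a - b) <= r%:R * e by rewrite ler_wpM2l//; lra.
have : 0 <= r%:R * (A - a - b) by rewrite mulr_ge0//; lra.
have : 0 <= r%:R * e by rewrite mulr_ge0.
move=> K1 K2 K3; rewrite ler_norml.
apply/andP; split; lra.
Qed.

(** * Entropy of skew-product partitions up to cocycle values *)

Section SkewPartition.
Context {R : realType} {Gamma : groupType} {d : measure_display}.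
Context {X : measurableType d} {G : topologicalGroupType}.
Variables (nu : probability X R) (alpha : Gamma -> X -> X).
Hypothesis halpha : measure_preserving_action nu alpha.
Variable beta : Gamma -> G -> G.
Variable sigma : Gamma -> X -> G.
Variable mu : probability (borel G) R.
Hypothesis msigma : forall g, measurable_fun [set: X] (sigma g : X -> borel G).
Hypothesis hbeta : @measure_preserving_action R Gamma _ (borel G) mu beta.

Let num : probability (X * borel G)%type R := (nu \x mu)%E.
Let skew : Gamma -> (X * borel G)%type -> (X * borel G)%type :=
  skew_product alpha beta sigma.
Hypothesis hskew : measure_preserving_action num skew.

Variable N : set G.
Hypothesis hN : normal_subgroup N.
Variable c : fpart mu.
Hypothesis cN : forall x y : G, c x = c y <-> N (x^-1 * y)%g.
Variable K : nat.
Hypothesis cK : forall x, (c x < K)%N.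

Let fstm : measure_preserving num nu fst := fst_measure_preserving nu mu.
Let sndm : measure_preserving num mu snd := snd_measure_preserving nu mu.
Let v : fpart num := pull sndm c.

Lemma mlabel_cocycle g : mlabel (fun x : X => c (sigma g x)).
Proof.
move=> k; rewrite (_ : _ @^-1` _ = sigma g @^-1` (c @^-1` [set k]))//.
rewrite -[_ @^-1` _]setTI; apply: msigma => //; exact: measurable_label.
Qed.

Definition cocycle_label g : fpart nu :=
  FPart (mlabel_cocycle g) (bounded_lty nu (mlabel_cocycle g) (fun x => cK _)).

(** The inverses appear because the translate of [v] by [w] reads its label after applying the
    action of [w^-1]. *)
Definition cocycle_vee (W : seq Gamma) : fpart nu :=
  foldr (fun w acc => vee (cocycle_label w^-1%g) acc) (fpart1 nu) W.

Lemma cocycle_veeE W x y : cocycle_vee W x = cocycle_vee W y <->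
  forall w, w \in W -> c (sigma w^-1%g x) = c (sigma w^-1%g y).
Proof.
elim: W => [|w W IH]; first by split.
rewrite -[cocycle_vee (w :: W)]/(vee (cocycle_label w^-1%g) (cocycle_vee W)).
rewrite veeE IH; split => [[e1 e2] w'|H].
  by rewrite inE => /predU1P[->|/e2].
by split => [|w' w'W]; apply: H; rewrite inE ?eqxx ?w'W ?orbT.
Qed.

(* Modulo the values of the cocycle, the translates of [v] under the skew
   product are the translates of [c] under [beta]; the latter are independent
   of everything depending on the first coordinate. *)
Lemma h_vee_skew (p : fpart nu) W :
  h (vee (vee (pull fstm p) (vee_over hskew W v)) (pull fstm (cocycle_vee W))) =
  h (vee p (cocycle_vee W)) + h (vee_over hbeta W c).
Proof.
rewrite -(h_product (vee p (cocycle_vee W)) (vee_over hbeta W c)).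
apply: h_eq => -[x y] [x' y'].
  move=> /veeE[/veeE[e1 /vee_overE e2] e3]; apply/veeE; split; first exact/veeE.
  apply/vee_overE => w wW; have := e2 w wW.
  rewrite /v /= /skew_product /= (coset_label_mul hN cN)//.
  by move/cocycle_veeE : e3; exact.
move=> /veeE[/veeE[e1 e3] /vee_overE e2]; apply/veeE; split => //.
apply/veeE; split => //; apply/vee_overE => w wW.
rewrite /v /= /skew_product /= (coset_label_mul hN cN); first exact: e2.
by move/cocycle_veeE : e3; exact.
Qed.

(** In the exact identity the cocycle partition occurs conditionally on both sides, and conditioning
    on more than [p] can only lower its entropy. *)
Lemma h_skew_ge p W : h p + h (vee_over hbeta W c) <=
  h (vee (pull fstm p) (vee_over hskew W v)).
Proof.
have E := h_vee_skew p W; rewrite !h_vee -h_vee in E.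
have : hc (pull fstm (cocycle_vee W)) (vee (pull fstm p) (vee_over hskew W v)) <=
    hc (cocycle_vee W) p.
  rewrite -(hc_pull fstm); apply: hc_refines => //.
  by move=> x y /veeE[].
lra.
Qed.

Lemma h_skew_le p W : h (vee (pull fstm p) (vee_over hskew W v)) <=
  h p + h (vee_over hbeta W c) + hc (cocycle_vee W) p.
Proof.
have E := h_vee_skew p W; rewrite !h_vee -h_vee in E.
have := hc_ge0 (pull fstm (cocycle_vee W))
  (vee (pull fstm p) (vee_over hskew W v)).
lra.
Qed.

Context {r : nat}.
Variable s : 'I_r -> Gamma.
Variable p : fpart nu.

Let u : fpart num := pull fstm p.

(** The window of the join term for the generator [s i]: a partition over [W] joined with its
    translate. *)
Definition double_seq (i : 'I_r) (W : seq Gamma) : seq Gamma :=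
  W ++ [seq (s i * w)%g | w <- W].

Lemma vee_over_doubleE (d' : measure_display) (T : measurableType d')
    (m : probability T R) (a : Gamma -> T -> T)
    (ha : measure_preserving_action m a) (q : fpart m) i W x y :
  vee_over ha (double_seq i W) q x = vee_over ha (double_seq i W) q y <->
  vee_over ha W q x = vee_over ha W q y /\
  tshift ha (s i) (vee_over ha W q) x = tshift ha (s i) (vee_over ha W q) y.
Proof.
split=> [/vee_overE H|[/vee_overE e1 /vee_overE e2]]; last first.
  apply/vee_overE => w; rewrite mem_cat => /orP[/e1//|/mapP[w' /e2 + ->]].
  by rewrite invgM !(actM ha).
split; apply/vee_overE => w wW; first by apply: H; rewrite mem_cat wW.
rewrite -!(actM ha) -invgM; apply: H.
by rewrite mem_cat orbC map_f.
Qed.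

Lemma vee_ball_fst m z t : vee_ball s hskew m u z = vee_ball s hskew m u t <->
  vee_ball s halpha m p z.1 = vee_ball s halpha m p t.1.
Proof. by rewrite !vee_ballE. Qed.

(** For fixed [n] finitely many cocycle values enter F, so one large [m] makes their conditional
    entropy small in all r + 1 entropies at once. *)
Lemma F_skew_approx n (e : R) :
  asymptotically_generating s halpha p -> 0 < e ->
  exists m0, forall m, (m0 <= m)%N ->
   `|F_label s hskew (vee (vee_ball s hskew m u) (vee_ball s hskew n v)) -
     (F_label s halpha (vee_ball s halpha m p) + F_label s hbeta (vee_ball s hbeta n c))|
   <= e.
Proof.
move=> gp e0; pose Wn := ball_seq s n.
(* A single window containing the ball and all the doubled balls. *)
pose Wall := Wn ++ flatten [seq double_seq i Wn | i <- enum 'I_r].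
pose e' := e / (2 * r%:R + 1).
have re0 : 0 < 2 * r%:R + 1 :> R by rewrite ltr_wpDl// mulr_ge0.
have e'0 : 0 < e' by rewrite divr_gt0.
have ee' : e = 2 * r%:R * e' + e'.
  have -> : 2 * r%:R * e' + e' = (2 * r%:R + 1) * e' by ring.
  by rewrite /e' mulrCA divff ?gt_eqF// mulr1.
have [m0 hm0] := gp (cocycle_vee Wall) e' e'0.
exists m0 => m /hm0 hm.
pose pm := vee_ball s halpha m p.
have hW W (q : fpart nu) : {subset W <= Wall} -> refines q pm ->
    hc (cocycle_vee W) q <= e'.
  move=> WW qpm; apply: le_trans hm; apply: hc_refines => //.
  by move=> x y /cocycle_veeE H; apply/cocycle_veeE => w /WW; exact: H.
have E1 : h (vee (vee_ball s hskew m u) (vee_ball s hskew n v)) =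
    h (vee (pull fstm pm) (vee_over hskew Wn v)).
  apply: h_eq => x y /veeE[e1 e2]; apply/veeE; split => //.
    exact/vee_ball_fst.
  exact/vee_ball_fst.
have E2 i : h (vee (vee (vee_ball s hskew m u) (vee_ball s hskew n v))
      (tshift hskew (s i) (vee (vee_ball s hskew m u) (vee_ball s hskew n v)))) =
    h (vee (pull fstm (vee pm (tshift halpha (s i) pm)))
           (vee_over hskew (double_seq i Wn) v)).
  apply: h_eq => x y.
    move=> /veeE[/veeE[/vee_ball_fst e1 e2] /veeE[/vee_ball_fst e3 e4]].
    apply/veeE; split; first by apply/veeE; split; [exact: e1|exact: e3].
    by apply/vee_over_doubleE; split; [exact: e2|exact: e4].
  move=> /veeE[/veeE[e1 e3] /vee_over_doubleE[e2 e4]].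
  apply/veeE; split; apply/veeE; split.
  - exact/vee_ball_fst.
  - exact: e2.
  - exact/vee_ball_fst.
  - exact: e4.
have L1 := h_skew_ge pm Wn; have U1 := h_skew_le pm Wn.
have {}U1 : h (vee (pull fstm pm) (vee_over hskew Wn v)) <=
    h pm + h (vee_over hbeta Wn c) + e'.
  apply: (le_trans U1); rewrite lerD2l; apply: (hW Wn pm); last by move=> x y.
  by move=> w wW; rewrite mem_cat wW.
pose q i := vee pm (tshift halpha (s i) pm).
have U2 i : h (vee (pull fstm (q i)) (vee_over hskew (double_seq i Wn) v)) <=
    h (q i) + h (vee_over hbeta (double_seq i Wn) c) + e'.
  apply: (le_trans (h_skew_le _ _)); rewrite lerD2l; apply: (hW (double_seq i Wn) (q i)).
    move=> w wW; rewrite mem_cat; apply/orP; right; apply/flattenP.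
    exists (double_seq i Wn); last exact: wW.
    by apply: map_f; rewrite mem_enum.
  by move=> x y /veeE[].
have L2 i := h_skew_ge (q i) (double_seq i Wn).
have E3 i : h (vee (vee_ball s hbeta n c) (tshift hbeta (s i) (vee_ball s hbeta n c))) =
    h (vee_over hbeta (double_seq i Wn) c).
  by apply: h_eq => x y; [move=> /veeE/vee_over_doubleE|move=> /vee_over_doubleE/veeE].
have FE := congr2 (fun x y => (1 - 2 * r%:R) * x + y) E1
  (eq_bigr _ (fun i _ => E2 i) : \sum_(i < r) _ = _).
have FB := congr1 (fun y => (1 - 2 * r%:R) * h (vee_ball s hbeta n c) + y)
  (eq_bigr _ (fun i _ => E3 i) : \sum_(i < r) _ = _).
rewrite ee' [X in `|X - _|]FE [X in `|_ - (_ + X)|]FB.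
exact: (sum_error L1 U1 L2 U2 (ltW e'0)).
Qed.

End SkewPartition.

(** * Balls of different radii in a join *)

Section JointBalls.
Context {R : realType} {d : measure_display} {T : measurableType d}.
Context {Gamma : groupType} {r : nat}.
Variables (mu : probability T R) (s : 'I_r -> Gamma) (a : Gamma -> T -> T).
Hypothesis ha : measure_preserving_action mu a.
Implicit Types (u v : fpart mu).

Local Notation vee_ball := (vee_ball s ha).
Local Notation F := (F_label s ha).

Lemma vee_ball_vee n u v x y : vee_ball n (vee u v) x = vee_ball n (vee u v) y <->
  vee_ball n u x = vee_ball n u y /\ vee_ball n v x = vee_ball n v y.
Proof.
split=> [/vee_ballE H|[/vee_ballE H1 /vee_ballE H2]].
  by split; apply/vee_ballE => w /H /veeE[].
by apply/vee_ballE => w wn; apply/veeE; split; [exact: H1|exact: H2].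
Qed.

(** The balls of unequal radii already refine [vee u v], so the larger joint ball is reached by
    splitting. With the next lemma, this compares equal radii with the regime where [n] is fixed and
    [m] is large. *)
Lemma F_vee_ball_vee_le k m n u v : (m <= k)%N -> (n <= k)%N ->
  F (vee_ball k (vee u v)) <= F (vee (vee_ball m u) (vee_ball n v)).
Proof.
move=> mk nk; pose q := vee (vee_ball m u) (vee_ball n v).
have qr : refines q (vee u v).
  move=> x y /veeE[/refines_ball e1 /refines_ball e2]; apply/veeE; split.
    exact: e1.
  exact: e2.
apply: le_trans (F_vee_ball_le s ha k qr).
rewrite (@F_eq _ _ _ _ _ _ s _ ha _ (vee q (vee_ball k (vee u v))))//.
  move=> x y e; apply/veeE; split; last exact: e.
  move/vee_ball_vee : e => [e1 e2]; apply/veeE; split.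
    exact: (refines_ball_le mk) e1.
  exact: (refines_ball_le nk) e2.
by move=> x y /veeE[].
Qed.

Lemma F_vee_vee_ball_le k m u v : (k <= m)%N ->
  F (vee (vee_ball m u) (vee_ball k v)) <= F (vee_ball k (vee u v)).
Proof.
move=> km; pose q := vee_ball k (vee u v).
have qr : refines q u.
  by move=> x y /vee_ball_vee[/refines_ball].
apply: le_trans (F_vee_ball_le s ha m qr).
rewrite (@F_eq _ _ _ _ _ _ s _ ha _ (vee q (vee_ball m u)))//.
  move=> x y /veeE[e1 e2]; apply/veeE; split; last exact: e1.
  apply/vee_ball_vee; split; last exact: e2.
  exact: (refines_ball_le km) e1.
by move=> x y /veeE[/vee_ball_vee[_ e1] e2]; apply/veeE; split.
Qed.

End JointBalls.

(** Either infimum may be -oo, but nonempty sets of reals exclude +oo, so the sum is never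
    indeterminate. *)
Lemma ereal_inf_add (R : realType) (A B : set R) (x : \bar R) :
  A !=set0 -> B !=set0 ->
  (forall a b, A a -> B b -> (x <= (a + b)%:E)%E) ->
  (x <= ereal_inf (EFin @` A) + ereal_inf (EFin @` B))%E.
Proof.
move=> [a0 Aa0] [b0 Bb0] H.
case: x H => [x| |] H; last by rewrite leNye.
- have HB b : B b -> ((x - b)%:E <= ereal_inf (EFin @` A))%E.
    move=> Bb; apply: le_ereal_inf_tmp => _ [a Aa <-].
    by have := H a b Aa Bb; rewrite !lee_fin lerBlDr.
  have Ale : (ereal_inf (EFin @` A) <= a0%:E)%E.
    by apply: ereal_inf_lbound; exists a0.
  move: HB Ale; case: (ereal_inf (EFin @` A)) => [a| |] HB //.
    move=> _; rewrite -leeBlDl//; apply: le_ereal_inf_tmp => _ [b Bb <-].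
    by have := HB b Bb; rewrite -EFinB !lee_fin; lra.
  by move=> _; have := HB b0 Bb0; rewrite leeNy_eq.
- by have := H _ _ Aa0 Bb0; rewrite leye_eq.
Qed.

Section SkewLimit.
Context {R : realType} {Gamma : groupType} {d : measure_display}.
Context {X : measurableType d} {G : topologicalGroupType}.
Variables (nu : probability X R) (alpha : Gamma -> X -> X).
Hypothesis halpha : measure_preserving_action nu alpha.
Variable beta : Gamma -> G -> G.
Variable sigma : Gamma -> X -> G.
Variable mu : probability (borel G) R.
Hypothesis msigma : forall g, measurable_fun [set: X] (sigma g : X -> borel G).
Hypothesis hbeta : @measure_preserving_action R Gamma _ (borel G) mu beta.

Let num : probability (X * borel G)%type R := (nu \x mu)%E.
Let skew : Gamma -> (X * borel G)%type -> (X * borel G)%type :=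
  skew_product alpha beta sigma.
Hypothesis hskew : measure_preserving_action num skew.

Variable N : set G.
Hypothesis hN : normal_subgroup N.
Variable c : fpart mu.
Hypothesis cN : forall x y : G, c x = c y <-> N (x^-1 * y)%g.
Variable K : nat.
Hypothesis cK : forall x, (c x < K)%N.
Context {r : nat}.
Variable s : 'I_r -> Gamma.
Variable p : fpart nu.
Hypothesis gp : asymptotically_generating s halpha p.

Let fstm : measure_preserving num nu fst := fst_measure_preserving nu mu.
Let sndm : measure_preserving num mu snd := snd_measure_preserving nu mu.
Let v : fpart num := pull sndm c.
Let u : fpart num := pull fstm p.

Lemma f_label_skew : f_label s hskew (vee u v) =
  (f_label s halpha p + f_label s hbeta c)%E.
Proof.
have approx := fun n e => @F_skew_approx _ _ _ _ _ nu alpha halpha beta sigma mu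
  msigma hbeta hskew N hN c cN K cK r s p n e gp.
pose Fk k := F_label s hskew (vee_ball s hskew k (vee u v)).
pose Fp m := F_label s halpha (vee_ball s halpha m p).
pose Fc n := F_label s hbeta (vee_ball s hbeta n c).
have FE : f_label s hskew (vee u v) =
  ereal_inf (EFin @` (Fk @` [set n | (0 < n)%N])) by rewrite image_comp.
have FpE : f_label s halpha p =
  ereal_inf (EFin @` (Fp @` [set n | (0 < n)%N])) by rewrite image_comp.
have FcE : f_label s hbeta c =
  ereal_inf (EFin @` (Fc @` [set n | (0 < n)%N])) by rewrite image_comp.
(* Both radii are arbitrary: the first is enlarged until the approximation applies, which only
   lowers the base value. *)
have up m1 n (e : R) : 0 < e -> (0 < m1)%N ->
    exists2 k, (0 < k)%N & Fk k <= Fp m1 + Fc n + e.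
  move=> e0 m10; have [m0 hm0] := approx n e e0.
  pose m := maxn m1 m0; pose k := maxn m n.
  exists k; first by rewrite !leq_max m10.
  have A := hm0 m (leq_maxr _ _).
  have B : Fk k <= F_label s hskew (vee (vee_ball s hskew m u) (vee_ball s hskew n v)).
    by apply: F_vee_ball_vee_le; [exact: leq_maxl|exact: leq_maxr].
  have C : Fp m <= Fp m1 by apply: F_ball_le; exact: leq_maxl.
  move: A; rewrite ler_norml => /andP[_]; rewrite -/(Fp m) -/(Fc n); lra.
(* The second radius stays at [k] and only the first grows. *)
have lo k (e : R) : 0 < e -> (0 < k)%N ->
    exists2 m, (0 < m)%N & Fp m + Fc k <= Fk k + e.
  move=> e0 k0; have [m0 hm0] := approx k e e0.
  pose m := maxn k m0; exists m; first by rewrite leq_max k0.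
  have A := hm0 m (leq_maxr _ _).
  have B : F_label s hskew (vee (vee_ball s hskew m u) (vee_ball s hskew k v)) <= Fk k.
    by apply: F_vee_vee_ball_le; exact: leq_maxl.
  move: A; rewrite ler_norml => /andP[+ _]; rewrite -/(Fp m) -/(Fc k); lra.
rewrite FE FpE FcE; apply/eqP; rewrite eq_le; apply/andP; split.
  apply: ereal_inf_add; [by exists (Fp 1%N), 1%N|by exists (Fc 1%N), 1%N|].
  move=> _ _ [m m0 <-] [n n0 <-]; apply/lee_addgt0Pr => e e0.
  have [k k0 Fle] := up m n e e0 m0.
  apply: (@le_trans _ _ (Fk k)%:E); last by rewrite -EFinD lee_fin.
  by apply: ereal_inf_lbound; exists (Fk k) => //; exists k.
apply: le_ereal_inf_tmp => _ [_ [k k0 <-] <-]; apply/lee_addgt0Pr => e e0.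
have [m m0 Fle] := lo k e e0 k0.
apply: (@le_trans _ _ ((Fp m)%:E + (Fc k)%:E)%E); last first.
  by rewrite -!EFinD lee_fin.
apply: leeD; apply: ereal_inf_lbound.
  by exists (Fp m) => //; exists m.
by exists (Fc k) => //; exists k.
Qed.

End SkewLimit.

(** * A generating partition for the skew product *)

Section SkewGenerating.
Context {R : realType} {Gamma : groupType} {d : measure_display}.
Context {X : measurableType d} {G : topologicalGroupType}.
Variables (nu : probability X R) (alpha : Gamma -> X -> X).
Hypothesis halpha : measure_preserving_action nu alpha.
Variable beta : Gamma -> G -> G.
Variable sigma : Gamma -> X -> G.
Variable mu : probability (borel G) R.
Hypothesis msigma : forall g, measurable_fun [set: X] (sigma g : X -> borel G).
Hypothesis hbeta : @measure_preserving_action R Gamma _ (borel G) mu beta.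

Let num : probability (X * borel G)%type R := (nu \x mu)%E.
Let skew : Gamma -> (X * borel G)%type -> (X * borel G)%type :=
  skew_product alpha beta sigma.
Hypothesis hskew : measure_preserving_action num skew.

Variable N : set G.
Hypothesis hN : normal_subgroup N.
Variable c : fpart mu.
Hypothesis cN : forall x y : G, c x = c y <-> N (x^-1 * y)%g.
Variable p : fpart nu.

Let fstm : measure_preserving num nu fst := fst_measure_preserving nu mu.
Let sndm : measure_preserving num mu snd := snd_measure_preserving nu mu.
Let v : fpart num := pull sndm c.
Let u : fpart num := pull fstm p.
Let z : fpart num := vee u v.

Variables (P : set (set X)) (Q : set (set (borel G))).
Hypothesis mP : P `<=` measurable.
Hypothesis mQ : Q `<=` measurable.
Hypothesis Pp : labels P p.
Hypothesis Qc : labels Q c.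
Hypothesis genP : forall B, measurable B ->
  exists2 A, smallest (invariant_sigma_algebra alpha) P A & nu (A `+` B) = 0%E.
Hypothesis genQ : forall B : set (borel G), measurable B ->
  exists2 A : set (borel G),
    smallest (@invariant_sigma_algebra _ (borel G) Gamma beta) Q A &
    mu (A `+` B) = 0%E.

Definition cells : set (set (X * borel G)) :=
  [set A | exists t, A = z @^-1` [set z t]].

Lemma labels_cells : labels cells z.
Proof. by []. Qed.

Let S0 := smallest (invariant_sigma_algebra skew) cells.
Let C := ae_in num S0.

Let invC : invariant_sigma_algebra skew C.
Proof. exact/(invariant_ae_in hskew)/invariant_smallest. Qed.

Lemma cells_preimage S : C (z @^-1` S).
Proof.
apply: ae_in_sub; last exact/mlabel_preimage/measurable_label.
have [[S00 _ SU] _] := invariant_smallest skew cells.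
pose B k := if `[< S k /\ exists t, z t = k >] then z @^-1` [set k] else set0.
rewrite (_ : _ @^-1` _ = \bigcup_k B k).
  apply: SU => k; rewrite /B; case: asboolP => [[_ [t <-]]|_]; last exact: S00.
  by apply: sub_smallest (@subset_refl _ _) _ _; exists t.
apply/seteqP; split => [t St|t [k _]].
  by exists (z t) => //; rewrite /B; case: asboolP => // -[]; split => //; exists t.
by rewrite /B; case: asboolP => // -[Sk _] /= zt; rewrite /preimage /= zt.
Qed.

Lemma refines_preimage (q : (X * borel G)%type -> nat) S :
  refines z q -> C (q @^-1` S).
Proof.
move=> /(refines_factor 0%N)[f fE].
have -> : q @^-1` S = z @^-1` (f @^-1` S) by rewrite fE.
exact: cells_preimage.
Qed.

(** The projection to [X] is equivariant, so the sets whose preimage lies in [C] form an invariant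
    sigma-algebra containing [P]. *)
Lemma fst_preimage_ae E : measurable E -> C (fst @^-1` E).
Proof.
have [[C0 CC CU] Ca] := invC.
move=> mE; have [E' sE' E'E] := genP mE.
have mE' : measurable E' by exact: (smallest_measurable halpha mP).
have CE' : C (fst @^-1` E').
  apply: (sE' [set A | C (fst @^-1` A)]); split; last first.
    move=> A /(labels_cell Pp)[S ->].
    by apply: (refines_preimage (q := u)) => x y /veeE[].
  split; first split.
  - by rewrite /= preimage_set0.
  - by move=> A /CC.
  - by move=> A /CU; rewrite /= preimage_bigcup.
  - move=> g A /(Ca g) /=; rewrite (act_image hskew) (act_image halpha).
    exact.
apply: (ae_in_null CE'); first exact: (fstm mE).1.
rewrite (_ : _ `+` _ = fst @^-1` (E' `+` E))//.
by rewrite (fstm _).2//; exact: measurable_setY.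
Qed.

(* On the set where [sigma g^-1] lies in a given coset, [beta g^-1 y] and
   [beta g^-1 y * sigma g^-1 x] determine each other modulo [N]. *)
Lemma translate_coset_ae g S :
  C ((fun t : X * borel G => c (beta g^-1%g t.2)) @^-1` S).
Proof.
have [[C0 CC CU] Ca] := invC.
(* When the cocycle value has coset label [k], membership of the uncorrected factor in [S] is read
   off from the label of the product. *)
pose Sk k : set nat :=
  [set j | exists x y : G, [/\ c y = k, S (c x) & j = c (x * y)%g]].
pose A k : set (X * borel G) :=
  fst @^-1` ((fun x => c (sigma g^-1%g x)) @^-1` [set k]).
pose B k := skew g^-1%g @^-1` (v @^-1` Sk k).
have CI D E : C D -> C E -> C (D `&` E).
  move=> CD CE.
  rewrite (_ : D `&` E =
    setT `\` \bigcup_n (if n is 0%N then setT `\` D else setT `\` E)).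
    by apply/CC/CU => -[|n]; exact: CC.
  apply/seteqP; split => [t [Dt Et]|t [_ nt]].
    by split => // -[[|n] _ [_]]; apply.
  split; apply: contrapT => nDt; apply: nt; first by exists 0%N.
  by exists 1%N.
rewrite (_ : _ @^-1` S = \bigcup_k (A k `&` B k)).
  apply: CU => k; apply: CI.
    exact/fst_preimage_ae/(mlabel_cocycle msigma).
  apply: (invariant_preimage hskew invC).
  by apply: (refines_preimage (q := v)) => x y /veeE[].
apply/seteqP; split => [[x y] /= Sy|[x y] [k _ [/= Ak [x' [y' [ky' Sx' xyE]]]]]].
  exists (c (sigma g^-1%g x)) => //; split => //=.
  by exists (beta g^-1%g y), (sigma g^-1%g x).
suff -> : c (beta g^-1%g y) = c x' by [].
have e : c (sigma g^-1%g x) = c y' by rewrite Ak ky'.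
exact/(coset_label_mul hN cN _ _ e).
Qed.

Lemma snd_preimage_ae (D : set (borel G)) : measurable D -> C (snd @^-1` D).
Proof.
have [[C0 CC CU] Ca] := invC.
move=> mD; have [D' sD' D'D] := genQ mD.
have mD' : measurable D' by exact: (smallest_measurable hbeta mQ).
pose pi g (t : X * borel G) : borel G := beta g^-1%g t.2.
have CD' : forall g, C (pi g @^-1` D').
  (* The projection to [G] is not equivariant for the skew product; requiring all [beta]-translates
     at once makes the class invariant. *)
  apply: (sD' [set A | forall g, C (pi g @^-1` A)]); split; last first.
    by move=> A /(labels_cell Qc)[S ->] g; exact: translate_coset_ae.
  split; first split.
  - by move=> g; rewrite /= preimage_set0.
  - by move=> A CA g; exact: CC (CA g).
  - by move=> A CA g; rewrite preimage_bigcup; apply: CU => n; exact: CA.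
  - move=> g A CA g'; rewrite (act_image hbeta).
    have := CA (g' * g)%g; congr C; apply/seteqP; split => t /=;
    by rewrite /pi /preimage /= invgM (actM hbeta).
have {}CD' : C (snd @^-1` D').
  have := CD' 1%g; congr C; apply/seteqP; split => t /=;
  by rewrite /pi /preimage /= invg1 (act1 hbeta).
apply: (ae_in_null CD'); first exact: (sndm mD).1.
rewrite (_ : _ `+` _ = snd @^-1` (D' `+` D))//.
by rewrite (sndm _).2//; exact: measurable_setY.
Qed.

Lemma generating_skew : generating num skew cells.
Proof.
split; first by apply: (@labels_partition _ _ _ z); [exact: measurable_label|].
have [[C0 CC CU] Ca] := invC.
move=> B mB; suff [_ [A [SA _ AB]]] : C B by exists A.
move: B mB; apply: smallest_sub => //.
rewrite subUset; split => _ [A mA <-]; rewrite setTI.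
  exact: fst_preimage_ae.
exact: snd_preimage_ae.
Qed.

End SkewGenerating.

(** * Coset partition and conclusion *)

Lemma word_ball_cover (Gamma : groupType) r (s : 'I_r -> Gamma) :
  free_generators s -> forall g, exists n, word_ball s n g.
Proof. by move=> hs g; have [w [[_ wg] _]] := hs g; exists (size w), w. Qed.

Lemma left_coset_label (G : groupType) (N : set G) (c : G -> nat) :
  normal_subgroup N -> labels (left_cosets N) c ->
  forall x y, c x = c y <-> N (x^-1 * y)%g.
Proof.
move=> hN cc x y.
have x0 : (c @^-1` [set c x]) !=set0 by exists x.
have [|g _ gN] := (cc _ x0).2; first by exists x.
have gx : N (g^-1 * x)%g by apply/left_cosetE; rewrite gN.
have -> : c x = c y <-> (c @^-1` [set c x]) y by split => /= ->.
rewrite -gN left_cosetE; split => [gy|xy].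
  have := subgroupM hN (subgroupV hN gx) gy.
  by rewrite invgM invgK mulgA mulgK.
by have := subgroupM hN gx xy; rewrite mulgA mulgK.
Qed.

Lemma finite_label_bounded (T : pointedType) (Q : set (set T)) (c : T -> nat) :
  labels Q c -> finite_set Q -> exists K, forall x, (c x < K)%N.
Proof.
(* Every label is that of a point chosen from its cell, hence lies in the image of a finite set. *)
move=> Qc /(finite_image (fun A => c (get A)))/finite_seqP[l lE].
exists (\max_(k <- l) k).+1 => x; rewrite ltnS.
apply: leq_bigmax_seq => //.
suff : [set` l] (c x) by [].
rewrite -lE; exists (c @^-1` [set c x]).
  by apply/Qc; exists x.
exact: (@getPex _ (c @^-1` [set c x]) (ex_intro _ x erefl)).
Qed.

Local Open Scope ereal_scope.

Theorem theorem3p3 (R : realType)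
  (Gamma : groupType) (r : nat) (s : 'I_r -> Gamma)
  (hs : free_generators s)
  (d : measure_display) (X : measurableType d) (nu : probability X R)
  (hX : standard_borel R X)
  (alpha : Gamma -> X -> X) (halpha : measure_preserving_action nu alpha)
  (G : topologicalGroupType)
  (Gcompact : compact [set: G]) (Gmetrizable : metrizable R G)
  (beta : Gamma -> G -> G) (hbeta : automorphism_action beta)
  (sigma : Gamma -> X -> G) (hsigma : cocycle alpha beta sigma)
  (mu : probability (borel G) R) (hmu : is_haar mu)
  (Gdisc : totally_disconnected [set: G])
  (hN : exists N : set G,
    [/\ normal_subgroup N, clopen N, finite_set (left_cosets N) &
        generating mu beta (left_cosets N)])
  (hP : exists P : set (set X), finite_entropy_generating nu alpha P) :
  let nu_mu := [the probability (X * borel G)%type R of nu \x mu] in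
  let skew := skew_product alpha beta sigma in
  (exists P, finite_entropy_generating nu_mu skew P) /\
  f_invariant s nu_mu skew = f_invariant s nu alpha + f_invariant s mu beta.
Proof.
have cover := word_ball_cover hs.
have mbeta := beta_measure_preserving_action Gcompact Gmetrizable hbeta hmu.
have mskew := skew_measure_preserving_action halpha Gcompact Gmetrizable
  hbeta hsigma hmu.
have [P gP] := hP; have [N [nN _ finN gN]] := hN.
have [p [Pp agp]] := generating_labels halpha cover gP.
have [mQ genQ] := gN; have [c0 mc0 Qc0] := exists_labels mQ.
have [K cK] := finite_label_bounded Qc0 finN.
pose c : fpart mu := FPart mc0 (bounded_lty mu mc0 cK).
have Qc : labels (left_cosets N) c := Qc0.
have cN : forall x y : G, c x = c y <-> N (x^-1 * y)%g :=
  left_coset_label nN Qc0.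
have fQ : finite_entropy_generating mu beta (left_cosets N).
  split; first exact: gN.
  by rewrite (entropy_labels mu Qc0); exact: (label_entropy_lty c).
have agc : asymptotically_generating s mbeta c.
  move=> q e e0; apply: (hc_ball_small mbeta cover _ genQ) e0 => A.
  exact: labels_cell.
have [[[_ mP _ _] genP] _] := gP; have [_ mQ' _ _] := mQ.
pose z := vee (pull (fst_measure_preserving nu mu) p)
  (pull (snd_measure_preserving nu mu) c).
have gz := generating_skew halpha (proj1 hsigma) mbeta mskew nN cN mP mQ' Pp Qc
  genP genQ.
have zE : labels (cells c p) z by exact: labels_cells.
have fz : finite_entropy_generating (nu \x mu)
    (skew_product alpha beta sigma) (cells c p).
  split; first exact: gz.
  by rewrite (entropy_labels _ zE); exact: (label_entropy_lty z).
have agz : asymptotically_generating s mskew z.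
  move=> q e e0; apply: (hc_ball_small mskew cover _ gz.2) e0 => A.
  exact: (labels_cell zE).
move=> nu_mu skew; split; first by exists (cells c p).
rewrite (f_invariant_labels cover gP Pp agp).
rewrite (f_invariant_labels cover fQ Qc agc).
rewrite (f_invariant_labels cover fz zE agz).
exact: (f_label_skew (proj1 hsigma) mbeta mskew nN cN cK agp).
Qed.
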